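(* There is a one-to-one correspondence between the set of equivalence classes of valid QPG parameter arrays of class $d$ and valency $k_1$ and the exact isomorphism classes of standard integral table algebras of rank $d+1$ that are generated by an element of valency $k_1$. In particular, every relational quotient-polynomial graph of valency $k_1$ that generates a symmetric association scheme of class $d$ can be associated with a unique equivalence class of valid QPG parameter arrays with class $d$ and valency $k_1$.
   Context: Symmetric association scheme of class $d$: nonzero symmetric $0$-$1$ matrices $A_0=I,A_1,\dots,A_d$ with rows and columns indexed by a finite set, summing to the all-ones matrix, with $A_iA_j=\sum_{\ell}\lambda_{ij\ell}A_\ell$ for nonnegative integers $\lambda_{ij\ell}$ (intersection numbers). The valency $k_i$ is the row sum of $A_i$. Its rational adjacency algebra is $\mathrm{span}_{\mathbb{Q}}(A_0,\dots,A_d)$. Quotient-polynomial graph (QPG): a connected graph whose adjacency matrix $A$ generates the adjacency algebra of a symmetric association scheme, i.e. the rational adjacency algebra equals $\mathbb{Q}[A]$. It is relational if $A$ is one of the $A_j$; the relations are then labelled so that $A=A_1$. Standard integral table algebra (SITA) of rank $d+1$: an algebra with an involution $*$ and a distinguished $*$-closed basis $\{b_0=1,b_1,\dots,b_d\}$ such that $b_ib_j=\sum_\ell\lambda_{ij\ell}b_\ell$ with all structure constants $\lambda_{ij\ell}$ nonnegative integers; writing $b_{i^*}=(b_i)^*$, one has $\lambda_{ij0}\neq 0$ if and only if $j=i^*$, and $\lambda_{ii^*0}=\lambda_{i^*i0}>0$; and there is an algebra homomorphism $\delta$ to the scalars with $\delta(b_i)=\lambda_{ii^*0}$ for all $i$.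 The number $k_i=\delta(b_i)$ is the valency of the basis element $b_i$. The SITA is generated by an element $b$ if its rational span equals $\mathbb{Q}[b]$, so that every basis element is a rational polynomial in $b$. An exact isomorphism of SITAs is an algebra isomorphism mapping one distinguished basis bijectively onto the other. QPG parameter array of class $d$ and valency $k_1$: an array $$[[k_1,\dots,k_d],[\lambda_{112},\dots,\lambda_{11d};\lambda_{123},\dots,\lambda_{12d};\lambda_{134},\dots,\lambda_{1,d-1,d}]]$$ consisting of positive integers $k_i$ and nonnegative integers $\lambda_{1j\ell}$ for all $1\le j<\ell\le d$, such that the following $(d+1)\times(d+1)$ matrix $B_1$ (rows and columns indexed by $0,\dots,d$), called the intersection matrix determined by the array, has nonnegative integer entries: row $0$ has $k_1$ in column $1$ and $0$ elsewhere; column $0$ has $1$ in row $1$ and $0$ elsewhere; for $1\le j<\ell\le d$ the $(\ell,j)$ entry is $\lambda_{1j\ell}$ and the $(j,\ell)$ entry is $\lambda_{1j\ell}k_\ell/k_j$; the diagonal entries in rows $1,\dots,d$ are chosen so that every row sum is $k_1$. The array is valid if $B_1$ has nonnegative integer entries and $\mathbb{Q}[B_1]$ has a $\mathbb{Q}$-basis $\mathbf{B}=\{B_0=I,B_1,B_2,\dots,B_d\}$ that is the distinguished basis of a SITA and produces structure constants compatible with the list of valencies and parameters in the array (that is, $B_i$ has valency $k_i$, and the structure constants $\lambda_{1j\ell}$ with $1\le j<\ell\le d$ are those listed). Two valid QPG parameter arrays are equivalent if the intersection matrices they determine are conjugate by a $(d+1)\times(d+1)$ permutation matrix whose corresponding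 permutation lies in $\mathrm{Sym}(\{2,\dots,d\})$, i.e. fixes the indices $0$ and $1$.
   Formalization: The generating element of valency k_1 is a basis element fixed by the involution (else the group algebra of Z/3 with k_1=1 is a counterexample), and exact isomorphisms must preserve the chosen generator (else one algebra can give inequivalent arrays). *)

(* Defs.v *)
From HB Require Import structures.
From mathcomp Require Import all_boot all_order all_fingroup all_algebra all_field.

Set Implicit Arguments.
Unset Strict Implicit.
Unset Printing Implicit Defensive.

Import Order.TTheory GRing.Theory Num.Theory.

Local Open Scope ring_scope.

(* The index 1 among 0, ..., d; it differs from 0 only when 0 < d. *)
Definition idx1 (d : nat) : 'I_d.+1 := inord 1.

(* Equivalence classes are predicates rather than MathComp-Analysis sets: the
   universe of the type set is too small for classes of algebras. *)
Definition bijection_on (X Y : Type) (A : X -> Prop) (B : Y -> Prop)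
    (f : X -> Y) : Prop :=
  [/\ forall x, A x -> B (f x),
      forall x x', A x -> A x' -> f x = f x' -> x = x'
    & forall y, B y -> exists2 x, A x & f x = y].

(* Standard integral table algebras *)

Section TableAlgebra.
Variables (F : numFieldType) (A : falgType F) (d : nat).
Implicit Types (U : {vspace A}) (b : d.+1.-tuple A) (i j l : 'I_d.+1).

(* lambda_ijl: the coefficient of b_l in b_i * b_j (b is free whenever used). *)
Definition sconst b i j l : F := coord b l (tnth b i * tnth b j).

(* b is the distinguished basis of a SITA whose underlying algebra is the
   subalgebra U of A, with involution star and degree map delta; only the values
   of star and delta on U matter, and inv is the map i |-> i^* on indices. *)
Record is_sita U b (star : 'End(A)) (inv : 'I_d.+1 -> 'I_d.+1)
    (delta : 'Hom(A, F^o)) : Prop := IsSita {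
  sita_basisP : basis_of U b;
  sita_b0 : tnth b ord0 = 1;
  sita_closed : forall i j, tnth b i * tnth b j \in U;
  sita_starK : {in U, involutive star};
  sita_starM : {in U &, forall u v, star (u * v) = star v * star u};
  sita_starb : forall i, star (tnth b i) = tnth b (inv i);
  sita_nat : forall i j l, exists m : nat, sconst b i j l = m%:R;
  sita_dual : forall i j, sconst b i j ord0 <> 0 <-> j = inv i;
  sita_dualC : forall i, sconst b i (inv i) ord0 = sconst b (inv i) i ord0;
  sita_dual_gt0 : forall i, 0 < sconst b i (inv i) ord0;
  sita_deltaM : ahom_in U delta;
  sita_deltab : forall i, delta (tnth b i) = sconst b i (inv i) ord0
}.

(* The rational span of b equals Q[y]. *)
Definition rat_generated b (y : A) : Prop :=
  forall x : A,
    (exists c : 'I_d.+1 -> rat, x = \sum_i ratr (c i) *: tnth b i) <->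
    (exists p : {poly rat}, x = horner_alg y (map_poly ratr p)).

End TableAlgebra.

(* A SITA of rank d+1 with scalars F, with an enumeration of its basis *)
Record sita (F : numFieldType) (d : nat) := Sita {
  sita_alg : falgType F;
  sita_basis : d.+1.-tuple sita_alg;
  sita_star : 'End(sita_alg);
  sita_inv : 'I_d.+1 -> 'I_d.+1;
  sita_delta : 'Hom(sita_alg, F^o);
  _ : is_sita fullv sita_basis sita_star sita_inv sita_delta
}.

(* Basis elements are referred to by their index. *)
Definition sita_elt (F : numFieldType) (d : nat) (S : sita F d) (g : 'I_d.+1) :
  sita_alg S := tnth (sita_basis S) g.

(* S.2 is (the index of) a basis element of valency k1 generating S.1. It has to
   be self-adjoint, as the adjacency matrix of an undirected graph is; all
   elements of the algebra then are.  Without this, the group algebra of a cyclic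
   group of order 3 would qualify (d = 2, k1 = 1), although no parameter array
   describes it. *)
Definition gen_sita (F : numFieldType) (d k1 : nat)
    (S : sita F d * 'I_d.+1) : Prop :=
  [/\ sita_star S.1 (sita_elt S.1 S.2) = sita_elt S.1 S.2,
      rat_generated (sita_basis S.1) (sita_elt S.1 S.2)
    & sita_delta S.1 (sita_elt S.1 S.2) = k1%:R].

Definition exact_iso (F : numFieldType) (d : nat) (S T : sita F d)
    (f : 'AHom(sita_alg S, sita_alg T)) : Prop :=
  bijective f /\
  exists s : {perm 'I_d.+1}, forall i, f (sita_elt S i) = sita_elt T (s i).

(* Exact isomorphism of SITAs with a chosen generator.  The generator is
   preserved: a SITA may have two inequivalent generators of the same valency
   (for instance d = 2, b_1 b_1 = 3 + b_1 + b_2, b_1 b_2 = b_1 + 2 b_2,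
   b_2 b_2 = 3 + 2 b_1), giving inequivalent arrays. *)
Definition gen_sita_iso (F : numFieldType) (d : nat)
    (S T : sita F d * 'I_d.+1) : Prop :=
  exists f : 'AHom(sita_alg S.1, sita_alg T.1),
    exact_iso f /\ f (sita_elt S.1 S.2) = sita_elt T.1 T.2.

Definition gen_sita_class (F : numFieldType) (d k1 : nat)
    (S : sita F d * 'I_d.+1) : sita F d * 'I_d.+1 -> Prop :=
  fun T => gen_sita k1 T /\ gen_sita_iso S T.

Definition gen_sita_classes (F : numFieldType) (d k1 : nat) :
    (sita F d * 'I_d.+1 -> Prop) -> Prop :=
  fun C => exists2 S, gen_sita k1 S & C = gen_sita_class k1 S.

Arguments gen_sita_classes F d k1 C : clear implicits.

(* QPG parameter arrays *)

(* arr_k i is k_i and arr_lam j l is lambda_{1jl}.  Only the k_i with 0 < i and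
   the lambda_{1jl} with 0 < j < l belong to the array; is_array gives the other
   entries fixed values. *)
Record qpg_array (d : nat) := QpgArray {
  arr_k : 'I_d.+1 -> nat;
  arr_lam : 'I_d.+1 -> 'I_d.+1 -> nat
}.

Definition imx_offdiag (d : nat) (a : qpg_array d) (i j : 'I_d.+1) : rat :=
  if i == ord0 then (if j == idx1 d then (arr_k a (idx1 d))%:R else 0)
  else if j == ord0 then (i == idx1 d)%:R
  else if (j < i)%N then (arr_lam a j i)%:R
  else (arr_lam a i j)%:R * (arr_k a j)%:R / (arr_k a i)%:R.

Definition intersection_mx (d : nat) (a : qpg_array d) : 'M[rat]_d.+1 :=
  \matrix_(i, j)
    if (i == j) && (i != ord0)
    then (arr_k a (idx1 d))%:R - \sum_(l | l != i) imx_offdiag a i l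
    else imx_offdiag a i j.

Definition is_array (d : nat) (a : qpg_array d) : Prop :=
  [/\ arr_k a ord0 = 1%N,
      forall j l : 'I_d.+1, ~~ (0 < j < l)%N -> arr_lam a j l = 0%N,
      forall i, (0 < arr_k a i)%N
    & forall i j, exists m : nat, intersection_mx a i j = m%:R].

(* The valencies and the structure constants lambda_{1jl}, 1 <= j < l <= d, of
   the enumerated basis b are those of the array. *)
Definition compatible (F : numFieldType) (A : falgType F) (d : nat)
    (b : d.+1.-tuple A) (delta : 'Hom(A, F^o)) (a : qpg_array d) : Prop :=
  (forall i : 'I_d.+1, delta (tnth b i) = (arr_k a i)%:R) /\
  (forall j l : 'I_d.+1, (0 < j < l)%N ->
     sconst b (idx1 d) j l = (arr_lam a j l)%:R).

(* <<1; M>> is the subalgebra Q[M] of the algebra of matrices. *)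
Definition valid_array (d k1 : nat) (a : qpg_array d) : Prop :=
  [/\ is_array a, arr_k a (idx1 d) = k1
    & exists (B : d.+1.-tuple 'M[rat]_d.+1) (star : 'End('M[rat]_d.+1))
             (inv : 'I_d.+1 -> 'I_d.+1) (delta : 'Hom('M[rat]_d.+1, rat^o)),
      [/\ is_sita <<1; intersection_mx a>>%VS B star inv delta,
          tnth B (idx1 d) = intersection_mx a
        & compatible B delta a]].

Definition array_equiv (d : nat) (a a' : qpg_array d) : Prop :=
  exists s : {perm 'I_d.+1},
    [/\ s ord0 = ord0, s (idx1 d) = idx1 d
      & intersection_mx a' =
        perm_mx s *m intersection_mx a *m invmx (perm_mx s)].

Definition array_class (d k1 : nat) (a : qpg_array d) : qpg_array d -> Prop :=
  fun a' => valid_array k1 a' /\ array_equiv a a'.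

Definition array_classes (d k1 : nat) : (qpg_array d -> Prop) -> Prop :=
  fun C => exists2 a, valid_array k1 a & C = array_class k1 a.

Arguments array_classes d k1 C : clear implicits.

(* a is the array of S.1 for some enumeration of its basis starting with the
   identity and the generator S.2. *)
Definition array_of_sita (F : numFieldType) (d : nat)
    (S : sita F d * 'I_d.+1) (a : qpg_array d) : Prop :=
  exists s : {perm 'I_d.+1},
    [/\ s ord0 = ord0, s (idx1 d) = S.2
      & compatible [tuple sita_elt S.1 (s i) | i < d.+1] (sita_delta S.1) a].

(* Graphs and symmetric association schemes on the points 0, ..., n *)

Definition adj_mx (n : nat) (e : rel 'I_n.+1) : 'M[rat]_n.+1 :=
  \matrix_(x, y) (e x y)%:R.

Definition connected_graph (n : nat) (e : rel 'I_n.+1) : Prop :=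
  [/\ symmetric e, irreflexive e & forall x y, connect e x y].

Definition sym_scheme (n d : nat) (As : d.+1.-tuple 'M[rat]_n.+1)
    (lam : 'I_d.+1 -> 'I_d.+1 -> 'I_d.+1 -> nat) : Prop :=
  [/\ tnth As ord0 = 1,
      forall i, [/\ tnth As i <> 0, (tnth As i)^T = tnth As i
                  & forall x y, tnth As i x y = 0 \/ tnth As i x y = 1],
      \sum_i tnth As i = const_mx 1
    & forall i j,
        tnth As i * tnth As j = \sum_l (lam i j l)%:R *: tnth As l].

(* e is a quotient-polynomial graph generating the scheme As, and is the
   relation A_1 of that scheme. *)
Definition relational_qpg (n d : nat) (e : rel 'I_n.+1)
    (As : d.+1.-tuple 'M[rat]_n.+1)
    (lam : 'I_d.+1 -> 'I_d.+1 -> 'I_d.+1 -> nat) : Prop :=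
  [/\ connected_graph e, sym_scheme As lam, tnth As (idx1 d) = adj_mx e
    & <<As>>%VS = <<1; adj_mx e>>%VS].

Definition array_of_graph (n d : nat) (e : rel 'I_n.+1)
    (a : qpg_array d) : Prop :=
  exists (As : d.+1.-tuple 'M[rat]_n.+1)
         (lam : 'I_d.+1 -> 'I_d.+1 -> 'I_d.+1 -> nat),
    [/\ relational_qpg e As lam,
        forall i x, \sum_y tnth As i x y = (arr_k a i)%:R
      & forall j l : 'I_d.+1, (0 < j < l)%N ->
          lam (idx1 d) j l = arr_lam a j l].

(* Main.v *)
(* A symmetric table algebra is encoded by its structure constants lambda_ijl.
   Associativity and commutativity give lambda_ijl k_l = lambda_ilj k_j, so that
   the rows of L_i = (lambda_ijl)_lj sum to k_i; hence the array determines the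
   whole matrix L_1, which is the intersection matrix.  If b_1 generates, every
   L_i is a polynomial p_i(L_1), characterised by its column 0 being e_i; hence
   L_1 determines all structure constants.  So arrays, algebras with a generator,
   and the schemes of a graph are all classified by structure constants up to
   relabelling of the indices other than 0 and 1.

   The definition of a valid array does not ask that b_1 be self-adjoint.  Put
   x = B_1 - B_1^*: as a polynomial in the intersection matrix, x is self-adjoint
   for the inner product weighted by the valencies, so its eigenvalues are real;
   as x^* = -x, multiplication by x on the table algebra is skew-adjoint, with
   imaginary eigenvalues.  Both operators have the same minimal polynomial, so
   x = 0. *)
Require Import Defs.
From HB Require Import structures.
From mathcomp Require Import all_boot all_order all_fingroup all_algebra all_field.
From Stdlib Require Import FunctionalExtensionality PropExtensionality.

Set Implicit Arguments.
Unset Strict Implicit.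
Unset Printing Implicit Defensive.

Import Order.TTheory GRing.Theory Num.Theory.

Local Open Scope ring_scope.

(** * Structure constants of symmetric table algebras *)

Lemma natr_inj (R : numDomainType) (m n : nat) : m%:R = n%:R :> R -> m = n.
Proof. by move/eqP; rewrite eqr_nat => /eqP. Qed.

Section Tables.
Variable d : nat.
Implicit Types (i j l m h g : 'I_d.+1) (s : {perm 'I_d.+1}).
Implicit Types (lam : 'I_d.+1 -> 'I_d.+1 -> 'I_d.+1 -> nat).

(** The involution is trivial here, so the valency of [b_i] is [lam i i ord0] and no separate degree
    map is stored; [table_deg] makes the valencies multiplicative. *)
Record sym_table lam : Prop := SymTable {
  table_1 : forall j l, lam ord0 j l = (j == l);
  table_C : forall i j l, lam i j l = lam j i l;
  table_A : forall i j m l,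
    (\sum_h lam i j h * lam h m l = \sum_h lam j m h * lam i h l)%N;
  table_dual : forall i j, i != j -> lam i j ord0 = 0%N;
  table_gt0 : forall i, (0 < lam i i ord0)%N;
  table_deg : forall i j,
    (\sum_l lam i j l * lam l l ord0 = lam i i ord0 * lam j j ord0)%N
}.

(** Left multiplication by [b_i] on coordinate columns. For a symmetric table, column 0 is the unit
    vector at [i]. *)
Definition table_mx lam i : 'M[rat]_d.+1 := \matrix_(l, j) (lam i j l)%:R.

(** The polynomials are rational whatever the scalars of the algebra, so this depends on the
    structure constants alone. *)
Definition generates lam g : Prop :=
  forall i, exists p, table_mx lam i = horner_mx (table_mx lam g) p.

(** Compare the coefficients of [b_0] in [(b_j b_i) b_l] and [b_j (b_i b_l)]: duality leaves one
    term on each side. *)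
Lemma table_swap lam i j l : sym_table lam ->
  (lam i j l * lam l l ord0 = lam i l j * lam j j ord0)%N.
Proof.
move=> tl; have := table_A tl j i l ord0.
rewrite (bigD1 l) //= big1 ?addn0; last first.
  by move=> h hl; rewrite (table_dual tl) ?muln0.
rewrite (bigD1 j) //= big1 ?addn0; last first.
  by move=> h hj; rewrite (table_dual tl (i := j)) ?muln0 // eq_sym.
by rewrite (table_C tl j i).
Qed.

(** After multiplication by the valency of [b_l], [table_swap] turns the row sum into the degree
    identity for [b_i b_l]. *)
Lemma table_row_sum lam i l : sym_table lam ->
  (\sum_j lam i j l = lam i i ord0)%N.
Proof.
move=> tl; apply/eqP; rewrite -(eqn_pmul2r (table_gt0 tl l)) big_distrl /=.
by rewrite -(table_deg tl); apply/eqP/eq_bigr => j _; rewrite table_swap.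
Qed.

Lemma idx1_neq0 : (0 < d)%N -> idx1 d != ord0.
Proof. by move=> d_gt0; apply/eqP=> /(congr1 val); rewrite /= inordK. Qed.

Lemma table_idx0 lam j l : sym_table lam -> lam j ord0 l = (j == l).
Proof. by move=> tl; rewrite (table_C tl) (table_1 tl). Qed.

(* Both sides have constant row sums, so the diagonal may be ignored. *)
Lemma intersection_mx_table a lam : (0 < d)%N -> sym_table lam ->
    (forall i, arr_k a i = lam i i ord0) ->
    (forall j l, (0 < j < l)%N -> arr_lam a j l = lam (idx1 d) j l) ->
  intersection_mx a = table_mx lam (idx1 d).
Proof.
move=> d_gt0 tl ak al.
have off i j : i != j -> imx_offdiag a i j = (lam (idx1 d) j i)%:R.
  rewrite /imx_offdiag => ij; have [i0|i_n0] := eqVneq i ord0.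
    have [->|j1] := eqVneq j (idx1 d); first by rewrite ak i0.
    by rewrite i0 (table_dual tl) // eq_sym.
  have [->|j_n0] := eqVneq j ord0.
    by rewrite table_idx0 // eq_sym.
  have [ij'|] := ltnP j i; first by rewrite al // lt0n j_n0.
  rewrite leq_eqVlt => /orP [/eqP /val_inj e|ij']; first by rewrite e eqxx in ij.
  (* Above the diagonal the entry is rescaled by [k_j / k_i], which [table_swap] undoes. *)
  rewrite al ?lt0n ?i_n0 // !ak -natrM table_swap // natrM mulfK //.
  by rewrite pnatr_eq0 -lt0n table_gt0.
apply/matrixP => i j; rewrite !mxE; case: ifP => [/andP [/eqP <- i_n0]|].
  rewrite (eq_bigr (fun l => (lam (idx1 d) l i)%:R)); last first.
    by move=> l li; rewrite off // eq_sym.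
  rewrite ak -(table_row_sum (idx1 d) i tl) (bigD1 i) //= natrD natr_sum.
  by rewrite addrK.
have [<- /=|ij _] := eqVneq i j; last exact: off.
move/negbFE/eqP=> ->.
by rewrite /imx_offdiag eqxx eq_sym (negPf (idx1_neq0 d_gt0)) table_idx0 //
  (negPf (idx1_neq0 d_gt0)).
Qed.

Lemma table_mx0 lam : sym_table lam -> table_mx lam ord0 = 1.
Proof.
by move=> tl; apply/matrixP => l j; rewrite !mxE (table_1 tl) eq_sym.
Qed.

Lemma table_mxM lam i j : sym_table lam ->
  table_mx lam i * table_mx lam j = \sum_h (lam i j h)%:R *: table_mx lam h.
Proof.
move=> tl; apply/matrixP => l m; rewrite mxE summxE.
transitivity ((\sum_h lam j m h * lam i h l)%N%:R : rat).
  by rewrite natr_sum; apply: eq_bigr => h _; rewrite !mxE mulnC natrM.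
rewrite -(table_A tl) natr_sum.
by apply: eq_bigr => h _; rewrite !mxE natrM.
Qed.

Lemma horner_alg_mx (K : fieldType) n (M : 'M[K]_n.+1) p :
  horner_alg M p = horner_mx M p.
Proof.
elim/poly_ind: p => [|p c IHp]; first by rewrite !rmorph0.
rewrite !rmorphD !rmorphM /= horner_algX horner_mx_X IHp horner_algC.
by rewrite horner_mx_C -scalemx1.
Qed.

(** * Polynomials in a basis element and the regular representation *)

Section Regular.
Variables (F : numFieldType) (A : falgType F) (b : d.+1.-tuple A).

Lemma regular_horner (x : A) (Y : 'M[rat]_d.+1) :
    (forall j, x * tnth b j = \sum_l ratr (Y l j) *: tnth b l) ->
  forall p j, horner_alg x (map_poly ratr p) * tnth b j =
    \sum_l ratr (horner_mx Y p l j) *: tnth b l.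
Proof.
move=> xb; elim/poly_ind => [|p c IHp] j.
  rewrite !rmorph0 mul0r big1 // => l _.
  by rewrite mxE rmorph0 scale0r.
rewrite !rmorphD !rmorphM /= map_polyX horner_algX horner_mx_X.
rewrite map_polyC /= horner_algC horner_mx_C mulrDl -mulrA xb mulr_sumr.
rewrite (eq_bigr (fun l => \sum_h ratr (Y l j) *:
    (ratr (horner_mx Y p h l) *: tnth b h))); last first.
  by move=> l _; rewrite -scaler_sumr -IHp scalerAr.
rewrite exchange_big /= -scalerAl mul1r.
rewrite [X in _ + X](_ : _ = \sum_l ratr (c%:M l j) *: tnth b l); last first.
  rewrite (bigD1 j) //= big1 ?addr0 ?mxE ?eqxx // => l lj.
  by rewrite mxE (negPf lj) rmorph0 scale0r.
rewrite -big_split; apply: eq_bigr => l _ /=.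
rewrite !mxE rmorphD /= scalerDl rmorph_sum scaler_suml; congr (_ + _).
by apply: eq_bigr => h _; rewrite scalerA rmorphM mulrC.
Qed.

Definition has_table lam :=
  forall i j, tnth b i * tnth b j = \sum_l (lam i j l)%:R *: tnth b l.

Lemma table_horner lam g p j : has_table lam ->
  horner_alg (tnth b g) (map_poly ratr p) * tnth b j =
    \sum_l ratr (horner_mx (table_mx lam g) p l j) *: tnth b l.
Proof.
move=> bl; apply: regular_horner => {}j; rewrite bl.
by apply: eq_bigr => l _; rewrite mxE ratr_nat.
Qed.

Lemma free_coefs (c c' : 'I_d.+1 -> F) : free b ->
  \sum_i c i *: tnth b i = \sum_i c' i *: tnth b i -> c =1 c'.
Proof.
move=> fb e i.
have tb : forall c : 'I_d.+1 -> F,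
    \sum_i c i *: tnth b i = \sum_(i < d.+1) c i *: b`_i.
  by move=> c0; apply: eq_bigr => l _; rewrite (tnth_nth 0).
by rewrite -(coord_sum_free c i fb) -tb e tb coord_sum_free.
Qed.

(** Multiplication by [b_i = p(b_g)] has matrix [table_mx lam i], but also [p] of the matrix of
    [b_g]; freeness identifies the two. *)
Lemma generates_of_horner lam g : tnth b ord0 = 1 -> free b -> has_table lam ->
    sym_table lam ->
    (forall i, exists p : {poly rat},
       tnth b i = horner_alg (tnth b g) (map_poly ratr p)) ->
  generates lam g.
Proof.
move=> b0 fb bl tl gb i; have [p bi] := gb i; exists p.
apply/matrixP => l j; apply: (fmorph_inj (ratr : {rmorphism rat -> F})).
have := table_horner g p j bl; rewrite -bi bl => /(free_coefs fb)/(_ l) /= <-.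
by rewrite mxE ratr_nat.
Qed.

(** Apply [p(b_g)] to [b_0 = 1]: the coordinates of the result are column 0 of [table_mx lam i], the
    unit vector at [i]. *)
Lemma horner_of_generates lam g i :
    tnth b ord0 = 1 -> has_table lam -> sym_table lam -> generates lam g ->
  exists p : {poly rat}, tnth b i = horner_alg (tnth b g) (map_poly ratr p).
Proof.
move=> b0 bl tl /(_ i) [p lp]; exists p.
rewrite -[RHS]mulr1 -b0 (table_horner g p ord0 bl) -lp (bigD1 i) //=.
rewrite mxE table_idx0 // eqxx rmorph1 scale1r big1 ?addr0 // => l li.
by rewrite mxE table_idx0 // eq_sym (negPf li) rmorph0 scale0r.
Qed.

Lemma rat_generated_table lam g :
    tnth b ord0 = 1 -> has_table lam -> sym_table lam -> generates lam g ->
  rat_generated b (tnth b g).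
Proof.
move=> b0 bl tl gl x; split=> [[c ->]|[p ->]]; last first.
  exists (fun l => horner_mx (table_mx lam g) p l ord0).
  by rewrite -(table_horner _ _ _ bl) b0 mulr1.
have [p bp] := fin_all_exists (fun i => horner_of_generates i b0 bl tl gl).
exists (\sum_i c i *: p i); rewrite !rmorph_sum /=; apply: eq_bigr => i _.
by rewrite map_polyZ /= linearZ /= mulr_algl -bp.
Qed.

End Regular.

Lemma map_poly_ratr (p : {poly rat}) : map_poly ratr p = p.
Proof. by apply: map_poly_id => x _; rewrite -(fmorph_eq_rat idfun). Qed.

(** If [table_mx lam i] is [p] of the common matrix, its column 0 is the unit vector at [i]. In the
    algebra of [lam'], [p] of the generator then has the coordinates of [b_i], so it is [b_i], and
    the two tables have the same matrices. *)
Lemma table_mx_inj lam lam' g : sym_table lam -> sym_table lam' ->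
    generates lam g -> table_mx lam g = table_mx lam' g ->
  lam = lam'.
Proof.
move=> tl tl' gl e; apply: functional_extensionality => i.
apply: functional_extensionality => j; apply: functional_extensionality => l.
suff: table_mx lam i = table_mx lam' i.
  move/matrixP/(_ l j); rewrite !mxE => /eqP.
  by rewrite eqr_nat => /eqP.
have [p ip] := gl i.
pose b : d.+1.-tuple 'M[rat]_d.+1 := [tuple table_mx lam' h | h < d.+1].
have bl : has_table b lam'.
  move=> i' j'; rewrite !tnth_mktuple table_mxM //.
  by apply: eq_bigr => h _; rewrite tnth_mktuple.
have := table_horner g p ord0 bl.
rewrite !tnth_mktuple map_poly_ratr horner_alg_mx table_mx0 // mulr1 -e -ip.
move=> ->; rewrite (bigD1 i) //= big1 => [|h hi].
  by rewrite mxE table_idx0 // eqxx rmorph1 scale1r addr0 tnth_mktuple.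
by rewrite mxE table_idx0 // eq_sym (negPf hi) rmorph0 scale0r.
Qed.

(** * Relabelling of the basis elements *)

Definition perm_table s lam : 'I_d.+1 -> 'I_d.+1 -> 'I_d.+1 -> nat :=
  fun i j l => lam (s i) (s j) (s l).

Lemma perm_mx_conj s (M : 'M[rat]_d.+1) :
  perm_mx s *m M *m invmx (perm_mx s) = \matrix_(i, j) M (s i) (s j).
Proof.
rewrite -[in LHS]row_permE -(mulmxK (unitmx_perm _ s) (\matrix_(_, _) _)).
congr (_ *m _); apply/matrixP => i j; rewrite !mxE.
rewrite (bigD1 ((s^-1)%g j)) //= !mxE permKV eqxx mulr1 big1 ?addr0 // => l.
rewrite !mxE => ne; case: eqP => [e|]; last by rewrite mulr0.
by rewrite -e permK eqxx in ne.
Qed.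

Lemma table_mx_perm s lam i :
  table_mx (perm_table s lam) i =
  perm_mx s *m table_mx lam (s i) *m invmx (perm_mx s).
Proof. by rewrite perm_mx_conj; apply/matrixP => l j; rewrite !mxE. Qed.

Lemma sym_table_perm s lam : s ord0 = ord0 ->
  sym_table lam -> sym_table (perm_table s lam).
Proof.
move=> s0 tl; rewrite /perm_table; split; rewrite ?s0 => *.
- by rewrite (table_1 tl) (inj_eq perm_inj).
- exact: (table_C tl).
- have f (G : 'I_d.+1 -> nat) : (\sum_h G (s h) = \sum_h G h)%N.
    by rewrite [RHS](reindex_inj (h := s) (@perm_inj _ s)).
  rewrite (f (fun h => lam _ _ h * lam h _ _)%N).
  by rewrite (f (fun h => lam _ _ h * lam _ h _)%N) (table_A tl).
- by rewrite (table_dual tl) // (inj_eq perm_inj).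
- exact: (table_gt0 tl).
- rewrite -(table_deg tl).
  by rewrite [RHS](reindex_inj (h := s) (@perm_inj _ s)).
Qed.

(** The permutation goes from the labels of [lam'] to those of [lam]. A table with its generator, up
    to this relation, is the common invariant of arrays, algebras and schemes. *)
Definition table_iso lam g lam' g' : Prop :=
  exists s, [/\ s ord0 = ord0, s g' = g & lam' = perm_table s lam].

Lemma table_iso_refl lam g : table_iso lam g lam g.
Proof.
exists 1%g; rewrite !perm1; split=> //; rewrite /perm_table.
apply: functional_extensionality => i; apply: functional_extensionality => j.
by apply: functional_extensionality => l; rewrite !perm1.
Qed.

Lemma table_iso_sym lam g lam' g' :
  table_iso lam g lam' g' -> table_iso lam' g' lam g.
Proof.
move=> [s [s0 sg ->]]; exists s^-1%g; rewrite -sg permK -[in LHS]s0 permK.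
split=> //; rewrite /perm_table.
apply: functional_extensionality => i; apply: functional_extensionality => j.
by apply: functional_extensionality => l; rewrite !permKV.
Qed.

Lemma table_iso_trans lam g lam' g' lam'' g'' :
  table_iso lam g lam' g' -> table_iso lam' g' lam'' g'' ->
  table_iso lam g lam'' g''.
Proof.
move=> [s [s0 sg ->]] [t [t0 tg ->]]; exists (t * s)%g.
rewrite !permM t0 tg; split=> //; rewrite /perm_table.
apply: functional_extensionality => i; apply: functional_extensionality => j.
by apply: functional_extensionality => l; rewrite !permM.
Qed.

(** The polynomials in the identity are scalar matrices, whereas the matrix of [b_1] has a nonzero
    entry in row 1 of column 0. *)
Lemma generates_neq0 lam g : (0 < d)%N -> sym_table lam -> generates lam g ->
  g != ord0.
Proof.
move=> d_gt0 tl gl; apply/eqP => g0; have [p] := gl (idx1 d).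
rewrite g0 table_mx0 //.
have [k ->] : exists k, horner_mx (1 : 'M[rat]_d.+1) p = k%:M.
  elim/poly_ind: p => [|p c [k IHp]]; first by exists 0; rewrite rmorph0 raddf0.
  exists (k + c); rewrite rmorphD rmorphM /= horner_mx_X horner_mx_C mulr1 IHp.
  by rewrite raddfD.
move/matrixP/(_ (idx1 d) ord0); rewrite !mxE table_idx0 // eqxx.
by rewrite (negPf (idx1_neq0 d_gt0)) => /eqP; rewrite oner_eq0.
Qed.

Lemma generates_perm s lam g :
  generates lam (s g) -> generates (perm_table s lam) g.
Proof.
move=> gl i; have [p lp] := gl (s i); exists p.
by rewrite !table_mx_perm lp horner_mx_uconj ?unitmx_perm.
Qed.

End Tables.

(** * Table algebras and their structure constants *)

Lemma coord_tnth (K : fieldType) (V : vectType K) n (b : n.-tuple V) i l :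
  free b -> coord b l (tnth b i) = (i == l)%:R.
Proof. by move=> fb; rewrite (tnth_nth 0) coord_free // eq_sym. Qed.

Section Sita.
Variables (F : numFieldType) (A : falgType F) (d : nat).
Implicit Types (U : {vspace A}) (b : d.+1.-tuple A) (i j l m h g : 'I_d.+1).

Lemma tnth_free_inj b i j : free b -> tnth b i = tnth b j -> i = j.
Proof.
move=> fb e; apply/eqP; have := coord_tnth i j fb.
by rewrite e coord_tnth // eqxx => /esym/eqP; rewrite pnatr_eq1 eqb1.
Qed.

Lemma coord_basis_tnth U b (v : A) : basis_of U b -> v \in U ->
  v = \sum_i coord b i v *: tnth b i.
Proof.
move=> bU vU; rewrite [LHS](coord_basis bU vU).
by apply: eq_bigr => i _; rewrite (tnth_nth 0).
Qed.

Lemma sconst_table b lam i j l : free b -> has_table b lam ->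
  sconst b i j l = (lam i j l)%:R.
Proof.
move=> fb bl; rewrite /sconst bl linear_sum (bigD1 l) //= big1 => [|h hl].
  by rewrite linearZ /= coord_tnth // eqxx mulr1 addr0.
by rewrite linearZ /= coord_tnth // (negPf hl) mulr0.
Qed.

Lemma has_table_assoc b lam i j m l : free b -> has_table b lam ->
  (\sum_h lam i j h * lam h m l = \sum_h lam j m h * lam i h l)%N.
Proof.
move=> fb bl; apply/eqP; rewrite -(eqr_nat F); apply/eqP.
pose f h := (\sum_k lam i j k * lam k m h)%N%:R : F.
pose f' h := (\sum_k lam j m k * lam i k h)%N%:R : F.
suff /(free_coefs fb)/(_ l): \sum_h f h *: tnth b h = \sum_h f' h *: tnth b h.
  by [].
transitivity (tnth b i * tnth b j * tnth b m).
  rewrite bl mulr_suml /f.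
  under eq_bigr do rewrite natr_sum scaler_suml.
  rewrite exchange_big /=; apply: eq_bigr => k _.
  rewrite -scalerAl bl scaler_sumr; apply: eq_bigr => h _.
  by rewrite scalerA natrM.
rewrite -mulrA bl mulr_sumr /f'.
under [RHS]eq_bigr do rewrite natr_sum scaler_suml.
rewrite exchange_big /=; apply: eq_bigr => k _.
rewrite -scalerAr bl scaler_sumr; apply: eq_bigr => h _.
by rewrite scalerA natrM.
Qed.

Section OfSita.
Variables (U : {vspace A}) (b : d.+1.-tuple A) (star : 'End(A)).
Variables (inv : 'I_d.+1 -> 'I_d.+1) (delta : 'Hom(A, F^o)).
Hypothesis sU : is_sita U b star inv delta.

Lemma sita_free : free b. Proof. exact: basis_free (sita_basisP sU). Qed.

Lemma sita_mem i : tnth b i \in U.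
Proof. exact: basis_mem (sita_basisP sU) (mem_tnth i b). Qed.

Lemma sita_mem1 : 1 \in U.
Proof. by rewrite -(sita_b0 sU) sita_mem. Qed.

Lemma sita_memM u v : u \in U -> v \in U -> u * v \in U.
Proof.
move=> uU vU; rewrite (coord_basis_tnth (sita_basisP sU) uU).
rewrite (coord_basis_tnth (sita_basisP sU) vU) mulr_suml memv_suml // => i _.
rewrite mulr_sumr memv_suml // => j _.
by rewrite -scalerAr -scalerAl !memvZ // (sita_closed sU).
Qed.

Lemma sita_inv0 : inv ord0 = ord0.
Proof.
apply/esym/(sita_dual sU); rewrite /sconst (sita_b0 sU) mul1r -(sita_b0 sU).
by rewrite coord_tnth ?sita_free // eqxx; apply/eqP; rewrite oner_eq0.
Qed.

Lemma sita_star1 : star 1 = 1.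
Proof. by rewrite -(sita_b0 sU) (sita_starb sU) sita_inv0. Qed.

Lemma sita_horner_mem y p : y \in U -> horner_alg y p \in U.
Proof.
move=> yU; elim/poly_ind: p => [|p c IHp]; first by rewrite rmorph0 mem0v.
rewrite rmorphD rmorphM /= horner_algX horner_algC memvD ?sita_memM //.
by rewrite memvZ ?sita_mem1.
Qed.

Lemma sita_star_horner y p : y \in U -> star y = y ->
  star (horner_alg y p) = horner_alg y p.
Proof.
move=> yU sy; elim/poly_ind: p => [|p c IHp]; first by rewrite rmorph0 linear0.
rewrite rmorphD rmorphM /= horner_algX horner_algC linearD /=.
rewrite (sita_starM sU) ?sita_horner_mem // sy IHp linearZ /= sita_star1.
by congr (_ + _); have := congr1 (horner_alg y) (mulrC 'X p);
  rewrite !rmorphM /= horner_algX.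
Qed.

(** Generation by a self-adjoint element makes the basis elements commute and be self-adjoint, so
    [inv] is the identity; the table axioms are then those of [is_sita] read off on coefficients. *)
Lemma table_of_sita (y : A) : y \in U -> star y = y ->
    (forall i, exists p : {poly F}, tnth b i = horner_alg y p) ->
  exists lam, [/\ sym_table lam, has_table b lam
    & forall i, delta (tnth b i) = (lam i i ord0)%:R].
Proof.
move=> yU sy gy; have fb := sita_free.
have bC i j : tnth b i * tnth b j = tnth b j * tnth b i.
  have [[p ->] [q ->]] := (gy i, gy j).
  by rewrite -!rmorphM mulrC.
have invE i : inv i = i.
  apply: (tnth_free_inj fb); rewrite -(sita_starb sU).
  by have [p ->] := gy i; rewrite sita_star_horner.
have [lam lamE] : exists lam, forall i j l,
    sconst b i j l = (lam i j l : nat)%:R.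
  have [f fE] := fin_all_exists (fun t : 'I_d.+1 * 'I_d.+1 * 'I_d.+1 =>
    sita_nat sU t.1.1 t.1.2 t.2).
  by exists (fun i j l => f (i, j, l)) => i j l; rewrite (fE (i, j, l)).
have bl : has_table b lam.
  move=> i j.
  rewrite [LHS](coord_basis_tnth (sita_basisP sU)) ?(sita_closed sU) //.
  by apply: eq_bigr => l _; rewrite -lamE.
have dl i : delta (tnth b i) = (lam i i ord0)%:R.
  by rewrite (sita_deltab sU) invE lamE.
exists lam; split=> //; split.
- move=> j l; apply: (@natr_inj F).
  by rewrite -lamE /sconst (sita_b0 sU) mul1r coord_tnth.
- by move=> i j l; apply: (@natr_inj F); rewrite -!lamE /sconst bC.
- by move=> i j m l; apply: has_table_assoc fb bl.
- move=> i j ij; apply: (@natr_inj F); rewrite -lamE; apply/eqP/negPn/negP.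
  by move/eqP/(sita_dual sU) => e; rewrite e invE eqxx in ij.
- by move=> i; have := sita_dual_gt0 sU i; rewrite invE lamE ltr0n.
- move=> i j; apply: (@natr_inj F); rewrite natrM -!dl.
  have [dM _] := ahom_inP (sita_deltaM sU).
  rewrite -dM ?sita_mem // bl linear_sum natr_sum; apply: eq_bigr => l _.
  by rewrite linearZ /= dl natrM.
Qed.

End OfSita.

(** By commutativity the identity map reverses products, so it serves as involution; the degree map
    extends the valencies linearly. *)
Lemma sita_of_table U b lam : basis_of U b -> tnth b ord0 = 1 ->
    has_table b lam -> sym_table lam ->
  exists delta, is_sita U b \1%VF id delta /\
    forall i, delta (tnth b i) = (lam i i ord0)%:R.
Proof.
move=> bU b0 bl tl; have fb := basis_free bU.
have mb i : tnth b i \in U by exact: basis_mem bU (mem_tnth i b).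
pose f (u : A) : F^o := \sum_i coord b i u * (lam i i ord0)%:R.
have f_lin : linear f.
  move=> k u v; rewrite /f scaler_sumr -big_split; apply: eq_bigr => i _ /=.
  by rewrite linearP mulrDl -[_ *: _]/(_ * _) mulrA.
pose fL := GRing.isLinear.Build F A F^o _ f f_lin.
pose fl : {linear A -> F^o} := HB.pack f fL.
pose delta : 'Hom(A, F^o) := linfun fl.
have db i : delta (tnth b i) = (lam i i ord0)%:R.
  rewrite lfunE /= /f (bigD1 i) //= coord_tnth // eqxx mul1r big1 ?addr0 //.
  by move=> h hi; rewrite coord_tnth // eq_sym (negPf hi) mul0r.
have bC i j : tnth b i * tnth b j = tnth b j * tnth b i.
  by rewrite !bl; apply: eq_bigr => l _; rewrite (table_C tl).
have UC : {in U &, commutative *%R}.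
  move=> u v uU vU; rewrite (coord_basis_tnth bU uU) (coord_basis_tnth bU vU).
  rewrite mulr_suml mulr_sumr.
  under eq_bigr => i _ do rewrite mulr_sumr.
  under [RHS]eq_bigr => i _ do rewrite mulr_suml.
  apply: eq_bigr => i _; apply: eq_bigr => j _.
  by rewrite -!scalerAl -!scalerAr bC !scalerA mulrC.
have dM i j : delta (tnth b i * tnth b j) = delta (tnth b i) * delta (tnth b j).
  rewrite bl linear_sum !db -natrM -(table_deg tl) natr_sum.
  by apply: eq_bigr => l _; rewrite linearZ /= db natrM.
exists delta; split=> //; split=> //.
- by move=> i j; rewrite bl memv_suml // => l _; rewrite memvZ.
- by move=> u _; rewrite !id_lfunE.
- by move=> u v uU vU; rewrite !id_lfunE UC.
- by move=> i; rewrite id_lfunE.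
- by move=> i j l; exists (lam i j l); rewrite (sconst_table _ _ _ fb bl).
- move=> i j; rewrite (sconst_table i j ord0 fb bl).
  split=> [|->]; last by apply/eqP; rewrite pnatr_eq0 -lt0n table_gt0.
  move=> ne; apply/eqP; apply: contra_notT ne => ji.
  by rewrite (table_dual tl) // eq_sym.
- by move=> i; rewrite (sconst_table i i ord0 fb bl) ltr0n table_gt0.
- apply/ahom_inP; split; last by rewrite -b0 db (table_1 tl) eqxx.
  move=> u v uU vU; rewrite (coord_basis_tnth bU uU) (coord_basis_tnth bU vU).
  rewrite mulr_suml !linear_sum mulr_suml; apply: eq_bigr => i _.
  rewrite !mulr_sumr linear_sum; apply: eq_bigr => j _.
  rewrite -scalerAl -scalerAr !linearZ /= dM.
  by rewrite -![_ *: _]/(_ * _) mulrACA !mulrA.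
- by move=> i; rewrite db (sconst_table i i ord0 fb bl).
Qed.

End Sita.

(** * Self-adjointness of the generator *)

(** A generated subalgebra is a sum of powers of a subspace; the [n]-th power contains only
    polynomials in [y] of degree at most [n]. *)
Lemma adjoin1_powers (K : fieldType) (A : falgType K) (y : A) n :
  ((1 + <[y]>) ^+ n <= <<mkseq (fun k => (y ^+ k)%R) n.+1>>)%VS.
Proof.
elim: n => [|n IHn].
  by rewrite expv0 -memvE memv_span // mem_head.
rewrite expvSl; apply/prodvP => u v /memv_addP [_ /vlineP [a ->]].
move=> [_ /vlineP [c ->] ->] /(subvP IHn) vS.
rewrite (coord_span (X := in_tuple _) vS) mulr_sumr memv_suml // => i _.
have lin : (i < n.+1)%N.
  by rewrite -[X in (_ < X)%N](size_mkseq (fun k => y ^+ k)).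
rewrite nth_mkseq // -scalerAr memvZ // mulrDl mulr_algl -scalerAl -exprS.
rewrite memvD // memvZ // memv_span //; apply/mapP.
  by exists (i : nat); rewrite // mem_iota leq0n add0n ltnW.
by exists i.+1; rewrite // mem_iota leq0n add0n.
Qed.

Lemma adjoin1P (K : fieldType) (A : falgType K) (x y : A) :
  x \in <<1; y>>%VS <-> exists p : {poly K}, x = horner_alg y p.
Proof.
split=> [/memv_sumP [v vP ->]|[p ->]]; last first.
  elim/poly_ind: p => [|p c IHp]; first by rewrite rmorph0 mem0v.
  have U1 : (1 <= <<1; y>>)%VS by apply: sub1_agenv.
  rewrite rmorphD rmorphM /= horner_algX horner_algC memvD //; last first.
    by rewrite memvZ // memvE.
  by rewrite -agenvM memv_mul // memv_adjoin.
suff vp i : exists p : {poly K}, v i = horner_alg y p.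
  have [p pP] := fin_all_exists vp; exists (\sum_i p i).
  by rewrite rmorph_sum; apply: eq_bigr => i _.
have /(subvP (adjoin1_powers y i)) vS := vP i isT.
rewrite (coord_span (X := in_tuple _) vS).
exists (\sum_j coord (in_tuple (mkseq (fun k => y ^+ k) i.+1)) j (v i) *: 'X^j).
rewrite rmorph_sum /=; apply: eq_bigr => j _.
rewrite linearZ /= mulr_algl rmorphXn /= horner_algX nth_mkseq //.
by rewrite -[X in (_ < X)%N](size_mkseq (fun k => y ^+ k)).
Qed.

Section Weighted.
Variables (n : nat) (c : 'I_n.+1 -> rat).
Hypothesis c_gt0 : forall i, 0 < c i.
Implicit Types X : 'M[rat]_n.+1.

(* On column vectors, X is self-adjoint (eps = 1) or skew-adjoint (eps = -1) for
   the inner product with weights 1 / c. *)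
Definition weighted_adjoint (eps : rat) X :=
  forall i j, X i j * c j = eps * (X j i * c i).

(** For a row eigenvector [v] and the diagonal matrix [D] of the weights [c], the number [v X D v^*]
    equals [w] times [v D v^*], and conjugation multiplies it by [eps]. As [v D v^*] is positive, it
    cancels. *)
Lemma weighted_eigenvalue eps X (w : algC) : weighted_adjoint eps X ->
  eigenvalue (map_mx ratr X) w -> w^* = ratr eps * w.
Proof.
move=> eX /eigenvalueP [v vX v_n0].
pose N := \sum_j v 0 j * (v 0 j)^* * ratr (c j).
have N_gt0 : 0 < N.
  rewrite lt_def; apply/andP; split; last first.
    by apply: sumr_ge0 => j _; rewrite mulr_ge0 ?mul_conjC_ge0 // ler0q ltW.
  apply: contraNneq v_n0 => /psumr_eq0P Nz; apply/eqP/rowP => j; rewrite mxE.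
  have /eqP := Nz (fun j _ => mulr_ge0 (mul_conjC_ge0 (v 0 j))
    (etrans (ler0q _ (c j)) (ltW (c_gt0 j)))) j isT.
  by rewrite mulf_eq0 mul_conjC_eq0 fmorph_eq0 (gt_eqF (c_gt0 j)) orbF => /eqP.
pose S := \sum_j \sum_i v 0 i * ratr (X i j) * ((v 0 j)^* * ratr (c j)).
have SE : S = w * N.
  rewrite mulr_sumr; apply: eq_bigr => j _.
  have /rowP/(_ j) := vX; rewrite !mxE => e.
  rewrite !mulrA -e !mulr_suml; apply: eq_bigr => i _.
  by rewrite mxE !mulrA.
have Sc : S^* = ratr eps * S.
  rewrite rmorph_sum /S exchange_big mulr_sumr; apply: eq_bigr => i _.
  rewrite rmorph_sum mulr_sumr; apply: eq_bigr => j _ /=.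
  have rC a : ((ratr a : algC)^* = ratr a) by rewrite conj_Crat ?Crat_rat.
  have -> : ((v 0 j * ratr (X j i) * ((v 0 i)^* * ratr (c i)))^* =
      (v 0 j)^* * ratr (X j i) * (v 0 i * ratr (c i)) :> algC).
    rewrite rmorphM; congr (_ * _); rewrite rmorphM /= ?conjCK;
      by congr (_ * _); apply: rC.
  have := congr1 (ratr : rat -> algC) (eX j i); rewrite !rmorphM /= => e.
  transitivity ((v 0 j)^* * v 0 i * (ratr (X j i) * ratr (c i)) : algC).
    exact: mulrACA.
  rewrite e mulrCA; congr (_ * _); rewrite [_ * v 0 i]mulrC; exact: mulrACA.
have NR : N^* = N by apply/CrealP/gtr0_real.
apply: (mulIf (lt0r_neq0 N_gt0)).
by rewrite -mulrA -SE -Sc SE rmorphM /= NR.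
Qed.

Lemma weighted_horner X p : weighted_adjoint 1 X ->
  weighted_adjoint 1 (horner_mx X p).
Proof.
pose D := diag_mx (\row_j c j).
(* In this form self-adjointness passes to sums and to products of commuting matrices, hence to
   [p(X)]. *)
have DP (Y : 'M_n.+1) : weighted_adjoint 1 Y <-> Y *m D = D *m Y^T.
  have YD i j : (Y *m D) i j = Y i j * c j by rewrite mul_mx_diag !mxE.
  have DY i j : (D *m Y^T) i j = Y j i * c i by rewrite mul_diag_mx !mxE mulrC.
  split=> [sY|/matrixP sY i j]; last by rewrite mul1r -YD -DY.
  by apply/matrixP => i j; rewrite YD DY sY mul1r.
rewrite !DP => sX; elim/poly_ind: p => [|p k IHp].
  by rewrite rmorph0 trmx0 mul0mx mulmx0.
rewrite rmorphD rmorphM /= horner_mx_X horner_mx_C -[_ * _]/(_ *m _).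
have cX : horner_mx X p *m X = X *m horner_mx X p by apply: comm_horner_mx.
rewrite linearD /= tr_scalar_mx mulmxDl mulmxDr scalar_mxC {2}cX trmx_mul.
by rewrite -mulmxA sX !mulmxA IHp.
Qed.

Lemma weighted_sqr0 X : weighted_adjoint 1 X -> X * X = 0 -> X = 0.
Proof.
move=> sX XX; apply/matrixP => i j; rewrite mxE; apply/eqP.
(* By self-adjointness the diagonal entry of [X * X] at [i] is a sum of squares with positive
   weights. *)
have : \sum_k X i k ^+ 2 * c k / c i = 0.
  transitivity ((X * X) i i); last by rewrite XX mxE.
  rewrite mxE; apply: eq_bigr => k _; rewrite expr2 -!mulrA; congr (_ * _).
  by rewrite mulrA sX mul1r mulfK // lt0r_neq0.
move/psumr_eq0P => /(_ _ j isT) XK; have {XK}/eqP := XK (fun k _ =>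
  divr_ge0 (mulr_ge0 (sqr_ge0 (X i k)) (ltW (c_gt0 k))) (ltW (c_gt0 i))).
by rewrite !mulf_eq0 invr_eq0 !(gt_eqF (c_gt0 _)) !orbF orbb.
Qed.

(** Raise the exponent to a power of two, then halve it repeatedly: powers of [X] are again
    self-adjoint, so [weighted_sqr0] applies to them. *)
Lemma weighted_nilpotent X m : weighted_adjoint 1 X -> X ^+ m = 0 -> X = 0.
Proof.
move=> sX Xm; have : X ^+ (2 ^ m) = 0.
  by rewrite -(subnK (ltnW (ltn_expl m (isT : 1 < 2)%N))) exprD Xm mulr0.
elim: {Xm}m => [|m IHm] //; rewrite expnS mul2n -addnn exprD => Xm.
apply: IHm; apply: weighted_sqr0 Xm.
by rewrite -(horner_mx_X X) -rmorphXn; apply: weighted_horner.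
Qed.

(* X has a real spectrum and Y an imaginary one. *)
Lemma weighted_adjoint_eq0 X (Y : 'M[rat]_n.+1) :
    weighted_adjoint 1 X -> weighted_adjoint (-1) Y ->
    (forall p, horner_mx Y p = 0 -> horner_mx X p = 0) ->
  X = 0.
Proof.
move=> sX sY YX; pose XC : 'M[algC]_n.+1 := map_mx ratr X.
(* The minimal polynomial of [Y] annihilates [X], so an eigenvalue of [X] is also one of [Y]; it is
   both real and imaginary. *)
have rt (w : algC) : root (char_poly XC) w -> w = 0.
  rewrite -root_mxminpoly => Xw.
  have Yw : eigenvalue (map_mx ratr Y) w.
    rewrite eigenvalue_root_min -dvdp_XsubCl; move: Xw; rewrite -dvdp_XsubCl.
    move=> /dvdp_trans; apply; rewrite /XC !mxminpoly_map dvdp_map.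
    apply/mxminpoly_minP/YX.
    exact: mx_root_minpoly.
  rewrite -eigenvalue_root_min in Xw.
  have := weighted_eigenvalue sY Yw; rewrite (weighted_eigenvalue sX Xw).
  rewrite rmorph1 rmorphN1 mul1r mulN1r => /eqP.
  by rewrite -addr_eq0 -mulr2n mulrn_eq0 => /eqP.
(* With 0 as the only root, the characteristic polynomial is a power of the indeterminate, and
   Cayley-Hamilton makes [X] nilpotent. *)
have [r rP] := closed_field_poly_normal (char_poly XC).
rewrite (monicP (char_poly_monic _)) scale1r in rP.
have {}rP : char_poly XC = 'X^(size r).
  transitivity (\prod_(z <- r) 'X : {poly algC}); last first.
    by rewrite big_const_seq count_predT iter_mulr_1.
  rewrite [LHS]rP; apply: eq_big_seq => z zr.
  by rewrite (rt z) ?subr0 // rP root_prod_XsubC.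
have := Cayley_Hamilton XC; rewrite rP rmorphXn /= horner_mx_X.
rewrite -rmorphXn /= => XC0.
apply: (weighted_nilpotent (m := size r) sX).
by apply/eqP; rewrite -(map_mx_eq0 (ratr : {rmorphism rat -> algC})) XC0.
Qed.

End Weighted.

(** * Valid arrays *)

Lemma free_tnth (K : fieldType) (V : vectType K) n (b : n.-tuple V) :
    (forall c : 'I_n -> K, \sum_i c i *: tnth b i = 0 -> forall i, c i = 0) ->
  free b.
Proof.
move=> cb; apply/freeP => c c0; apply: cb; rewrite -[RHS]c0.
by apply: eq_bigr => i _; rewrite (tnth_nth 0).
Qed.

(** The span of [b] contains 1 and is stable under left multiplication by the generator, so it
    contains the generated subalgebra; conversely every [b_i] is a polynomial in the generator. *)
Lemma table_basis (F : numFieldType) (A : falgType F) d (b : d.+1.-tuple A)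
    lam g : tnth b ord0 = 1 -> has_table b lam -> sym_table lam ->
    generates lam g -> free b ->
  basis_of <<1; tnth b g>>%VS b.
Proof.
move=> b0 bl tl gl fb; rewrite basisEdim.
have bS i : tnth b i \in <<b>>%VS by rewrite memv_span ?mem_tnth.
have -> : (<<1; tnth b g>> <= <<b>>)%VS.
  have S1 : (1 <= <<b>>)%VS by rewrite -memvE -b0.
  apply: agenv_sub_modl => //; apply/prodvP => u v.
  move=> /memv_addP [_ /vlineP [k ->] [_ /vlineP [c ->] ->]] vS.
  rewrite mulrDl mulr_algl memvD ?memvZ // -scalerAl memvZ //.
  rewrite (coord_span vS) mulr_sumr memv_suml // => i _.
  rewrite -scalerAr memvZ // -tnth_nth bl memv_suml // => l _.
  by rewrite memvZ.
rewrite -(eqP fb) dimvS //.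
apply/span_subvP => _ /tnthP [i ->]; apply/adjoin1P.
by have [p ->] := horner_of_generates i b0 bl tl gl; eexists.
Qed.

Section ArrayTable.
Variable d : nat.
Hypothesis d_gt0 : (0 < d)%N.
Implicit Types (a : qpg_array d) (i j l g : 'I_d.+1).

Definition array_table a (lam : 'I_d.+1 -> 'I_d.+1 -> 'I_d.+1 -> nat) : Prop :=
  [/\ sym_table lam, generates lam (idx1 d),
      forall i, arr_k a i = lam i i ord0
    & forall j l, (0 < j < l)%N -> arr_lam a j l = lam (idx1 d) j l].

(** The matrices [table_mx lam i] are the required basis; they are free because their columns 0 are
    the unit vectors. *)
Lemma valid_array_of_table k1 a lam : array_table a lam ->
    (forall j l, ~~ (0 < j < l)%N -> arr_lam a j l = 0%N) ->
    arr_k a (idx1 d) = k1 ->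
  valid_array k1 a.
Proof.
move=> [tl gl ak al] a0 ak1; have imx := intersection_mx_table d_gt0 tl ak al.
split=> //; first split=> //.
- by rewrite ak (table_1 tl).
- by move=> i; rewrite ak table_gt0.
- by move=> i j; exists (lam (idx1 d) j i); rewrite imx mxE.
pose B := [tuple table_mx lam i | i < d.+1].
have B0 : tnth B ord0 = 1 by rewrite tnth_mktuple table_mx0.
have Bl : has_table B lam.
  move=> i j; rewrite !tnth_mktuple table_mxM //.
  by apply: eq_bigr => l _; rewrite tnth_mktuple.
have fB : free B.
  apply: free_tnth => c cB i; have /matrixP/(_ i ord0) := cB.
  rewrite summxE [RHS]mxE (bigD1 i) //= big1 => [|l li].
    by rewrite tnth_mktuple !mxE table_idx0 // eqxx mulr1 addr0.
  by rewrite tnth_mktuple !mxE table_idx0 // (negPf li) mulr0.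
have bB := table_basis B0 Bl tl gl fB.
have [delta [sB dB]] := sita_of_table bB B0 Bl tl.
exists B, \1%VF, id, delta; split; last 1 first.
- split=> [i|j l jl]; first by rewrite dB ak.
  by rewrite (sconst_table _ _ _ fB Bl) al.
- by rewrite imx; rewrite tnth_mktuple in sB.
- by rewrite tnth_mktuple.
Qed.

(** The factor [k_l / k_j] in the entries above the diagonal is exactly this symmetry; row and
    column 0 obey it since [k_0 = 1]. *)
Lemma intersection_mx_weighted a : is_array a ->
  weighted_adjoint (fun i => (arr_k a i)%:R^-1) 1 (intersection_mx a).
Proof.
move=> [k0 _ kp _]; have kn i : (arr_k a i)%:R != 0 :> rat.
  by rewrite pnatr_eq0 -lt0n.
have one_n0 := idx1_neq0 d_gt0.
have off i j : (i < j)%N -> imx_offdiag a i j * (arr_k a j)%:R^-1 =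
    imx_offdiag a j i * (arr_k a i)%:R^-1.
  move=> ij; rewrite /imx_offdiag; have j_n0 : j != ord0.
    by apply: contraTneq ij => ->.
  rewrite (negPf j_n0); have [i0|i_n0] := eqVneq i ord0.
    rewrite i0 k0 invr1 mulr1; have [->|j1] := eqVneq j (idx1 d).
      by rewrite divff.
    by rewrite mul0r.
  by rewrite ltnNge ltnW //= ij mulrAC mulfK.
move=> i j; rewrite mul1r; have [->//|ij] := eqVneq i j.
rewrite !mxE [j == i]eq_sym (negPf ij) /=.
by move: ij; rewrite neq_ltn => /orP [] /off.
Qed.

(** The inner product on the table algebra is the coefficient of [b_0] in [u * star v]: the basis is
    orthogonal and [b_i] has squared norm [k_i]. *)
Lemma valid_array_star a (B : d.+1.-tuple 'M[rat]_d.+1) star inv delta :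
    is_array a ->
    is_sita <<1; intersection_mx a>>%VS B star inv delta ->
    (forall i, delta (tnth B i) = (arr_k a i)%:R) ->
  star (intersection_mx a) = intersection_mx a.
Proof.
move=> ar sU dB; set M := intersection_mx a in sU *; set U := <<1; M>>%VS in sU.
have fB := sita_free sU.
have MU : M \in U by exact: memv_adjoin.
have kn i : (arr_k a i)%:R != 0 :> rat.
  by have [_ _ kp _] := ar; rewrite pnatr_eq0 -lt0n.
have starU u : u \in U -> star u \in U.
  move=> uU; rewrite (coord_basis_tnth (sita_basisP sU) uU) linear_sum.
  apply: memv_suml => i _.
  by rewrite linearZ /= memvZ // (sita_starb sU) (sita_mem sU).
have UC u v : u \in U -> v \in U -> u * v = v * u.
  by move=> /adjoin1P [p ->] /adjoin1P [q ->]; rewrite -!rmorphM mulrC.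
have invK i : inv (inv i) = i.
  apply: (tnth_free_inj fB); rewrite -!(sita_starb sU).
  by rewrite (sita_starK sU) ?(sita_mem sU).
have c0_inv i j : coord B ord0 (tnth B j * tnth B (inv i)) =
    (i == j)%:R * (arr_k a j)%:R.
  rewrite -dB (sita_deltab sU).
  have [->|ij] := eqVneq i j; first by rewrite mul1r.
  rewrite mul0r; apply/eqP/negPn/negP => /eqP /(sita_dual sU) e.
  by rewrite -(invK i) e invK eqxx in ij.
have c0_star u : u \in U -> coord B ord0 (star u) = coord B ord0 u.
  move=> uU; rewrite [in LHS](coord_basis_tnth (sita_basisP sU) uU) !linear_sum.
  rewrite (bigD1 ord0) //= big1 => [|i i_n0].
    rewrite !linearZ /= (sita_starb sU) (sita_inv0 sU).
    by rewrite coord_tnth // eqxx mulr1 addr0.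
  rewrite !linearZ /= (sita_starb sU) coord_tnth //; case: eqP => [e|].
    by rewrite -(invK i) e (sita_inv0 sU) eqxx in i_n0.
  by rewrite mulr0.
pose x := M - star M.
have xU : x \in U by rewrite memvB ?starU.
have sx : star x = - x by rewrite linearB /= (sita_starK sU) // opprB.
(* [x] is itself a matrix; [Y] is the matrix of multiplication by [x] in the distinguished basis. *)
pose Y : 'M[rat]_d.+1 := \matrix_(l, j) coord B l (x * tnth B j).
have xB j : x * tnth B j = \sum_l ratr (Y l j) *: tnth B l.
  rewrite [LHS](coord_basis_tnth (sita_basisP sU)).
    by apply: eq_bigr => l _; rewrite mxE -(fmorph_eq_rat idfun).
  by rewrite (sita_memM sU) ?(sita_mem sU).
have YE l j : Y l j * (arr_k a l)%:R =
    coord B ord0 (x * tnth B j * tnth B (inv l)).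
  rewrite xB mulr_suml linear_sum (bigD1 l) //= big1 => [|h hl].
    rewrite -scalerAl linearZ /= c0_inv eqxx mul1r addr0.
    by rewrite -(fmorph_eq_rat idfun).
  by rewrite -scalerAl linearZ /= c0_inv eq_sym (negPf hl) mul0r mulr0.
(* The involution preserves the coefficient of [b_0], exchanges the arguments of the inner product
   and turns [x] into [- x]; commutativity restores the order. *)
have sY : weighted_adjoint (fun i => (arr_k a i)%:R^-1) (-1) Y.
  move=> l j; suff e : Y l j * (arr_k a l)%:R = - (Y j l * (arr_k a j)%:R).
    apply: (mulIf (kn l)); apply: (mulIf (kn j)).
    by rewrite [LHS]mulrAC mulfVK // e mulN1r !mulNr mulfVK.
  rewrite !YE -c0_star ?(sita_memM sU) ?(sita_mem sU) //.
  rewrite !(sita_starM sU) ?(sita_memM sU) ?(sita_mem sU) //.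
  rewrite !(sita_starb sU) invK sx mulrN mulrN linearN /=.
  congr (- coord _ _ _).
  by rewrite mulrA UC ?(sita_memM sU) ?(sita_mem sU) ?mulrA.
have x0 : x = 0.
  have sX : weighted_adjoint (fun i => (arr_k a i)%:R^-1) 1 x.
    have /adjoin1P [p ->] := xU; rewrite horner_alg_mx.
    by apply: weighted_horner; apply: intersection_mx_weighted.
  apply: (weighted_adjoint_eq0 _ sX sY) => [i|p Yp].
    by rewrite invr_gt0 ltr0n; have [] := ar.
  (* Multiplying [b_0 = 1] by [p(x)] shows that [p(Y) = 0] forces [p(x) = 0]. *)
  rewrite -horner_alg_mx -[LHS]mulr1 -(sita_b0 sU) -(map_poly_ratr p).
  rewrite (regular_horner xB) Yp big1 // => l _.
  by rewrite mxE rmorph0 scale0r.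
by apply/esym/eqP; rewrite -subr_eq0 -/x x0.
Qed.

Lemma table_of_valid_array k1 a : valid_array k1 a ->
  exists lam, array_table a lam.
Proof.
move=> [ar ak [B [star [inv [delta [sU B1 [dB lB]]]]]]].
have sM := valid_array_star ar sU dB; have fB := sita_free sU.
have BM i : exists p : {poly rat}, tnth B i = horner_alg (intersection_mx a) p.
  by apply/adjoin1P; apply: sita_mem sU i.
have [lam [tl Bl dl]] := table_of_sita sU (memv_adjoin _ _) sM BM.
exists lam; split=> //.
- apply: (generates_of_horner (sita_b0 sU) fB Bl tl) => i.
  by have [p ->] := BM i; exists p; rewrite map_poly_ratr B1.
- by move=> i; apply: (@natr_inj rat); rewrite -dB dl.
- by move=> j l jl; apply: (@natr_inj rat); rewrite -lB // (sconst_table _ _ _ fB Bl).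
Qed.

End ArrayTable.

(** * Algebras with a generator *)

Section SitaTable.
Variables (F : numFieldType) (d : nat).
Implicit Types (S T : sita F d * 'I_d.+1) (i j l g : 'I_d.+1).
Implicit Types (s : {perm 'I_d.+1}).
Implicit Types (lam : 'I_d.+1 -> 'I_d.+1 -> 'I_d.+1 -> nat).

Definition sita_table S lam : Prop :=
  [/\ sym_table lam, generates lam S.2, has_table (sita_basis S.1) lam
    & forall i, sita_delta S.1 (sita_elt S.1 i) = (lam i i ord0)%:R].

Lemma sita_basis_full (S : sita F d) : basis_of fullv (sita_basis S).
Proof. by case: S => A b st inv delta sU; apply: sita_basisP sU. Qed.

Lemma sita_basis0 (S : sita F d) : tnth (sita_basis S) ord0 = 1.
Proof. by case: S => A b st inv delta sU; apply: sita_b0 sU. Qed.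

Lemma sita_basis_free (S : sita F d) : free (sita_basis S).
Proof. exact: basis_free (sita_basis_full S). Qed.

Lemma gen_sita_table k1 S : gen_sita k1 S -> exists2 lam,
  sita_table S lam & lam S.2 S.2 ord0 = k1.
Proof.
case: S => [[A b st inv delta sU] g] [/= sg gg dg].
have bg i : exists p : {poly rat},
    tnth b i = horner_alg (tnth b g) (map_poly ratr p).
  apply/gg; exists (fun l => (l == i)%:R).
  rewrite (bigD1 i) //= big1 => [|l li].
    by rewrite eqxx rmorph1 scale1r addr0.
  by rewrite (negPf li) rmorph0 scale0r.
have [lam [tl bl dl]] : exists lam, [/\ sym_table lam, has_table b lam
    & forall i, delta (tnth b i) = (lam i i ord0)%:R].
  apply: (table_of_sita sU (memvf _) sg) => i.
  by have [p ->] := bg i; exists (map_poly ratr p).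
exists lam; last by apply/eqP; rewrite -(eqr_nat F) -dl dg.
split=> //=; exact: generates_of_horner (sita_b0 sU) (sita_free sU) bl tl bg.
Qed.

(** The regular representation over [F] realizes the table inside a matrix algebra. Since the basis
    of a [sita] spans the whole algebra, the generated subalgebra is made an algebra type of its
    own. *)
Lemma gen_sita_exists lam g : sym_table lam -> generates lam g ->
  exists2 S, sita_table (S, g) lam & gen_sita (lam g g ord0) (S, g).
Proof.
move=> tl gl.
pose b := [tuple (map_mx ratr (table_mx lam i) : 'M[F]_d.+1) | i < d.+1].
have b0 : tnth b ord0 = 1 by rewrite tnth_mktuple table_mx0 // map_mx1.
have bl : has_table b lam.
  move=> i j; rewrite !tnth_mktuple -[_ * _]map_mxM -[_ *m _]/(_ * _).
  rewrite table_mxM // raddf_sum; apply: eq_bigr => l _ /=.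
  by rewrite map_mxZ tnth_mktuple rmorph_nat.
have fb : free b.
  apply: free_tnth => c cB i; have /matrixP/(_ i ord0) := cB.
  rewrite summxE [RHS]mxE (bigD1 i) //= big1 => [|l li].
    by rewrite tnth_mktuple !mxE table_idx0 // eqxx rmorph1 mulr1 addr0.
  by rewrite tnth_mktuple !mxE table_idx0 // (negPf li) rmorph0 mulr0.
have [U bU] : exists U : {aspace 'M[F]_d.+1}, basis_of U b.
  by exists <<1; tnth b g>>%AS; apply: table_basis bl tl gl fb.
have mb i : tnth b i \in U by exact: basis_mem bU (mem_tnth i b).
pose c : d.+1.-tuple (subvs_of U) := [tuple Subvs (mb i) | i < d.+1].
(* The unit of the subalgebra type is that of [U]; it is the identity matrix because [U] contains
   1. *)
have c0 : tnth c ord0 = 1.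
  apply: val_inj; rewrite tnth_mktuple /= b0; apply/esym/eqP.
  by rewrite algid_eq1; have := mb ord0; rewrite b0.
have vc i : vsval (tnth c i) = tnth b i by rewrite tnth_mktuple.
have cl : has_table c lam.
  move=> i j; apply: val_inj; rewrite linear_sum /= !vc bl.
  by apply: eq_bigr => l _; rewrite /= vc.
have fc : free c.
  apply: free_tnth => k kc; apply: (free_coefs (c' := fun=> 0) fb).
  transitivity (vsval (\sum_i k i *: tnth c i)).
    by rewrite linear_sum; apply: eq_bigr => i _; rewrite linearZ /= vc.
  by rewrite kc linear0 big1 // => i _; rewrite scale0r.
have cU : basis_of fullv c.
  rewrite basisEfree fc subvf dimvf size_tuple.
  exact: eq_leq (size_basis bU).
have [delta [sU dl]] := sita_of_table cU c0 cl tl.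
exists (Sita sU) => /=; first by split.
by split=> /=; [rewrite id_lfunE | apply: rat_generated_table gl | rewrite dl].
Qed.

(** An exact isomorphism matches the bases and hence the structure constants; conversely, the linear
    extension of a matching of the bases respects products, and the inverse permutation gives its
    inverse. *)
Lemma gen_sita_iso_table S T lam lam' : sita_table S lam -> sita_table T lam' ->
  gen_sita_iso S T <-> table_iso lam' T.2 lam S.2.
Proof.
move=> [tl gl bl dl] [tl' gl' bl' dl'].
have fS := sita_basis_free S.1; have fT := sita_basis_free T.1.
split=> [[f [[_ [s fs]] fg]]|[s [s0 sg e]]].
  exists s; split.
  - apply: (tnth_free_inj fT).
    by rewrite -[LHS]fs /sita_elt !sita_basis0 rmorph1.
  - by apply: (tnth_free_inj fT); rewrite -[LHS]fs.
  apply: functional_extensionality => i; apply: functional_extensionality => j.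
  apply: functional_extensionality => l; apply/eqP; rewrite -(eqr_nat F).
  apply/eqP.
  (* Coefficients are taken through the inverse permutation so that both sums run over the basis of
     [T]. *)
  pose c h : F := (lam i j h)%:R; pose c' h : F := (lam' (s i) (s j) (s h))%:R.
  suff e : \sum_h c ((s^-1)%g h) *: tnth (sita_basis T.1) h =
      \sum_h c' ((s^-1)%g h) *: tnth (sita_basis T.1) h.
    by have := free_coefs fT e (s l); rewrite permK.
  transitivity (f (sita_elt S.1 i * sita_elt S.1 j)).
    rewrite /sita_elt bl linear_sum (reindex_inj (h := s) (@perm_inj _ s)).
    by apply: eq_bigr => h _; rewrite permK linearZ /= -[tnth _ (s h)]fs.
  rewrite rmorphM /= !fs [LHS]bl'.
  by apply: eq_bigr => h _; rewrite /c' permKV.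
have lin (V W : vectType F) (b : d.+1.-tuple V) (c : 'I_d.+1 -> W) :
    free b -> exists f : 'Hom(V, W), forall i, f (tnth b i) = c i.
  move=> fb; pose f0 u := \sum_i coord b i u *: c i.
  have f_lin : linear f0.
    move=> k u v; rewrite /f0 scaler_sumr -big_split; apply: eq_bigr => i _ /=.
    by rewrite linearP scalerDl scalerA.
  pose fL := GRing.isLinear.Build F V W _ f0 f_lin.
  pose fl : {linear V -> W} := HB.pack f0 fL.
  exists (linfun fl) => i; rewrite lfunE /= /f0 (bigD1 i) //= big1 => [|h hi].
    by rewrite coord_tnth // eqxx scale1r addr0.
  by rewrite coord_tnth // eq_sym (negPf hi) scale0r.
have [f fE] := lin _ _ (sita_basis S.1) (fun i => sita_elt T.1 (s i)) fS.
have [h hE] := lin _ _ (sita_basis T.1) (fun i => sita_elt S.1 ((s^-1)%g i)) fT.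
have spanS u := coord_basis_tnth (sita_basis_full S.1) (memvf u).
have spanT u := coord_basis_tnth (sita_basis_full T.1) (memvf u).
have fM : ahom_in fullv f.
  apply/ahom_inP; split; last first.
    by rewrite -[in LHS](sita_basis0 S.1) fE s0 -(sita_basis0 T.1).
  have fbM i j : f (sita_elt S.1 i * sita_elt S.1 j) =
      f (sita_elt S.1 i) * f (sita_elt S.1 j).
    rewrite /sita_elt !fE bl linear_sum [RHS]bl'.
    rewrite [RHS](reindex_inj (h := s) (@perm_inj _ s)).
    by apply: eq_bigr => l _; rewrite linearZ /= fE e.
  move=> u v _ _; rewrite (spanS u) (spanS v) mulr_suml !linear_sum mulr_suml.
  apply: eq_bigr => i _; rewrite !mulr_sumr linear_sum; apply: eq_bigr => j _.
  rewrite -scalerAl -scalerAr !linearZ /= fbM.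
  by rewrite -scalerAl -scalerAr.
exists (AHom fM); split; last by rewrite /= fE sg.
split; last by exists s => i; rewrite /= fE.
exists h => u /=.
  rewrite {2}(spanS u) {1}(spanS u) !linear_sum; apply: eq_bigr => i _.
  by rewrite !linearZ /= fE hE permK.
rewrite {2}(spanT u) {1}(spanT u) !linear_sum; apply: eq_bigr => i _.
by rewrite !linearZ /= hE fE permKV.
Qed.

Hypothesis d_gt0 : (0 < d)%N.

Lemma array_of_sita_perm S lam a : sita_table S lam ->
  array_of_sita S a <-> exists s, [/\ s ord0 = ord0, s (idx1 d) = S.2
    & array_table a (perm_table s lam)].
Proof.
move=> [tl gl bl dl]; have fS := sita_basis_free S.1.
have sc s j l : sconst [tuple sita_elt S.1 (s i) | i < d.+1] (idx1 d) j l =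
    (perm_table s lam (idx1 d) j l)%:R.
  apply: sconst_table.
    apply: free_tnth => c cS i.
    rewrite -[i](permK s); apply: (free_coefs (c' := fun=> 0)
      (c := fun h => c ((s^-1)%g h)) fS).
    rewrite (reindex_inj (h := s) (@perm_inj _ s)).
    rewrite [RHS]big1 => [|h _]; last by rewrite scale0r.
    by rewrite -[RHS]cS; apply: eq_bigr => h _; rewrite permK tnth_mktuple.
  move=> i h; rewrite !tnth_mktuple [LHS]bl.
  rewrite (reindex_inj (h := s) (@perm_inj _ s)).
  by apply: eq_bigr => m _; rewrite tnth_mktuple.
have dE s i : s ord0 = ord0 ->
    sita_delta S.1 (tnth [tuple sita_elt S.1 (s i) | i < d.+1] i) = (perm_table s lam i i ord0)%:R.
  by move=> s0; rewrite tnth_mktuple dl /perm_table s0.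
split=> [[s [s0 s1 [ck cl]]]|[s [s0 s1 [_ _ ak al]]]]; exists s; split=> //.
  split; first exact: sym_table_perm.
  - by apply: generates_perm; rewrite s1.
  - by move=> i; apply: (@natr_inj F); rewrite -ck dE.
  - by move=> j l jl; apply: (@natr_inj F); rewrite -cl // sc.
by split=> [i|j l jl]; rewrite ?dE ?ak // sc al.
Qed.

(** In both tables the matrix of [b_1] is the intersection matrix of [a], and [b_1] generates. *)
Lemma array_table_fun a lam lam' : array_table a lam -> array_table a lam' ->
  lam = lam'.
Proof.
move=> [tl gl ak al] [tl' gl' ak' al']; apply: (table_mx_inj tl tl' gl).
by rewrite -(intersection_mx_table d_gt0 tl ak al)
  -(intersection_mx_table d_gt0 tl' ak' al').
Qed.

Lemma array_of_sitaE S lam a lam' : sita_table S lam -> array_table a lam' ->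
  array_of_sita S a <-> table_iso lam S.2 lam' (idx1 d).
Proof.
move=> Sl al; rewrite (array_of_sita_perm a Sl).
split=> [[s [s0 s1 al']]|[s [s0 s1 e]]]; exists s; split=> //.
  exact: array_table_fun al al'.
by rewrite -e.
Qed.

Lemma array_equivE a a' lam lam' : array_table a lam -> array_table a' lam' ->
  array_equiv a a' <-> table_iso lam (idx1 d) lam' (idx1 d).
Proof.
move=> [tl gl ak al] [tl' gl' ak' al'].
have imx := intersection_mx_table d_gt0 tl ak al.
have imx' := intersection_mx_table d_gt0 tl' ak' al'.
split=> [[s [s0 s1 e]]|[s [s0 s1 e]]]; exists s; split=> //.
  apply: (table_mx_inj (g := idx1 d) tl') => //; first exact: sym_table_perm.
  by rewrite table_mx_perm s1 -imx -imx' e.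
by rewrite imx imx' e table_mx_perm s1.
Qed.

Definition array_of_table lam : qpg_array d :=
  QpgArray (fun i => lam i i ord0)
    (fun j l => if (0 < j < l)%N then lam (idx1 d) j l else 0%N).

Lemma array_of_tableP lam k1 : sym_table lam -> generates lam (idx1 d) ->
    lam (idx1 d) (idx1 d) ord0 = k1 ->
  valid_array k1 (array_of_table lam) /\ array_table (array_of_table lam) lam.
Proof.
move=> tl gl lk; have al : array_table (array_of_table lam) lam.
  by split=> // j l jl; rewrite /= jl.
by split=> //; apply: valid_array_of_table al _ _ => // j l /= /negPf ->.
Qed.

End SitaTable.

(** * The correspondence *)

Lemma pred_ext T (P Q : T -> Prop) : (forall x, P x <-> Q x) -> P = Q.
Proof.
move=> PQ; apply: functional_extensionality => x.
exact: propositional_extensionality.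
Qed.

Section Correspondence.
Variables (F : numFieldType) (d k1 : nat).
Hypothesis d_gt0 : (0 < d)%N.
Implicit Types (a : qpg_array d) (S T : sita F d * 'I_d.+1).

Lemma array_class_eq a a' : valid_array k1 a -> valid_array k1 a' ->
  array_equiv a a' -> array_class k1 a = array_class k1 a'.
Proof.
move=> /(table_of_valid_array d_gt0) [lam al] /(table_of_valid_array d_gt0).
move=> [lam' al'] /(array_equivE d_gt0 al al') aa'.
apply: pred_ext => a''.
split=> -[va'']; have [l'' al''] := table_of_valid_array d_gt0 va''.
  move=> /(array_equivE d_gt0 al al'') aa''; split=> //.
  apply/(array_equivE d_gt0 al' al''); apply: table_iso_trans aa''.
  exact: table_iso_sym.
move=> /(array_equivE d_gt0 al' al'') aa''; split=> //.
by apply/(array_equivE d_gt0 al al''); apply: table_iso_trans aa''.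
Qed.

Lemma array_equiv_refl a : valid_array k1 a -> array_equiv a a.
Proof.
move=> /(table_of_valid_array d_gt0) [lam al].
by apply/(array_equivE d_gt0 al al); apply: table_iso_refl.
Qed.

(** Stated through all arrays of [C], so that no representative has to be chosen. *)
Definition sitas_of_arrays (C : qpg_array d -> Prop) :
    sita F d * 'I_d.+1 -> Prop :=
  fun T => gen_sita k1 T /\ exists2 a, C a & array_of_sita T a.

Lemma sitas_of_array_class a S : valid_array k1 a -> gen_sita k1 S ->
  array_of_sita S a -> sitas_of_arrays (array_class k1 a) = gen_sita_class k1 S.
Proof.
move=> va gS; have [lam al] := table_of_valid_array d_gt0 va.
have [lamS Sl _] := gen_sita_table gS.
move=> /(array_of_sitaE d_gt0 Sl al) Sa.
apply: pred_ext => T; split=> -[gT]; have [lamT Tl _] := gen_sita_table gT.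
  move=> [a' [va']]; have [lam' al'] := table_of_valid_array d_gt0 va'.
  move=> /(array_equivE d_gt0 al al') aa' /(array_of_sitaE d_gt0 Tl al') Ta'.
  split=> //; apply/(gen_sita_iso_table Sl Tl); apply: (table_iso_trans Ta').
  by apply/table_iso_sym/(table_iso_trans Sa).
move=> /(gen_sita_iso_table Sl Tl) TS; split=> //; exists a.
  by split=> //; apply: array_equiv_refl.
by apply/(array_of_sitaE d_gt0 Tl al); apply: table_iso_trans TS Sa.
Qed.

Lemma array_of_sita_equiv a S : valid_array k1 a -> gen_sita k1 S ->
  sitas_of_arrays (array_class k1 a) = gen_sita_class k1 S -> array_of_sita S a.
Proof.
move=> va gS e; have [lamS Sl _] := gen_sita_table gS.
have [_ [a' [va' aa']]] : sitas_of_arrays (array_class k1 a) S.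
  by rewrite e; split=> //; apply/(gen_sita_iso_table Sl Sl)/table_iso_refl.
have [lam al] := table_of_valid_array d_gt0 va.
have [lam' al'] := table_of_valid_array d_gt0 va'.
move: aa' => /(array_equivE d_gt0 al al') aa' /(array_of_sitaE d_gt0 Sl al') Sa'.
by apply/(array_of_sitaE d_gt0 Sl al)/(table_iso_trans Sa')/table_iso_sym.
Qed.

Lemma sita_of_array a : valid_array k1 a ->
  exists2 S : sita F d * 'I_d.+1, gen_sita k1 S & array_of_sita S a.
Proof.
move=> va; have [lam al] := table_of_valid_array d_gt0 va.
have [tl gl ak _] := al; have [S Sl gS] := gen_sita_exists F tl gl.
exists (S, idx1 d); last exact/(array_of_sitaE d_gt0 Sl al)/table_iso_refl.
by have [_ <- _] := va; rewrite ak.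
Qed.

Lemma array_of_gen_sita S : gen_sita k1 S ->
  exists2 a, valid_array k1 a & array_of_sita S a.
Proof.
move=> gS; have [lam Sl lk] := gen_sita_table gS; have [tl gl _ _] := Sl.
(* This transposition brings the generator to index 1; it fixes 0 because the generator is not the
   identity. *)
pose t := tperm (idx1 d) S.2.
have t0 : t ord0 = ord0.
  by rewrite tpermD ?idx1_neq0 //; apply: generates_neq0 gl.
have t1 : t (idx1 d) = S.2 by rewrite tpermL.
have [] := @array_of_tableP d d_gt0 (perm_table t lam) k1.
- exact: sym_table_perm.
- by apply: generates_perm; rewrite t1.
- by rewrite /perm_table t0 t1.
move=> va al; eexists; first exact: va.
by apply/(array_of_sitaE d_gt0 Sl al); exists t.
Qed.

Lemma sitas_of_arrays_bij :
  bijection_on (array_classes d k1) (gen_sita_classes F d k1) sitas_of_arrays.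
Proof.
split=> [_ [a va ->]|_ _ [a va ->] [a' va' ->] e|_ [S gS ->]].
- have [S gS Sa] := sita_of_array va.
  by exists S => //; apply: sitas_of_array_class.
- have [S gS Sa] := sita_of_array va.
  (* The images agree, so one algebra has both arrays, and its table links theirs. *)
  have Sa' : array_of_sita S a'.
    by apply: array_of_sita_equiv => //; rewrite -e; apply: sitas_of_array_class.
  apply: array_class_eq => //; have [lamS Sl _] := gen_sita_table gS.
  have [lam al] := table_of_valid_array d_gt0 va.
  have [lam' al'] := table_of_valid_array d_gt0 va'.
  apply/(array_equivE d_gt0 al al').
  move/(array_of_sitaE d_gt0 Sl al)/table_iso_sym: Sa => Sa.
  by move/(array_of_sitaE d_gt0 Sl al')/(table_iso_trans Sa): Sa'.
have [a va Sa] := array_of_gen_sita gS.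
by exists (array_class k1 a); [exists a | apply: sitas_of_array_class].
Qed.

End Correspondence.

(** * Association schemes *)

Section Scheme.
Variables (n d : nat).
Implicit Types (e : rel 'I_n.+1) (As : d.+1.-tuple 'M[rat]_n.+1).
Implicit Types (lam : 'I_d.+1 -> 'I_d.+1 -> 'I_d.+1 -> nat).

(** The partition of the pairs of points, as a labelling. Since every label occurs, identities
    between tables can be checked at matrix entries. *)
Definition relation_of As (r : 'I_n.+1 -> 'I_n.+1 -> 'I_d.+1) : Prop :=
  (forall i x y, tnth As i x y = (r x y == i)%:R) /\
  forall i, exists xy, r xy.1 xy.2 = i.

(** At each entry the 0-1 values sum to 1, so exactly one matrix has a 1 there. *)
Lemma scheme_relation As lam : sym_scheme As lam -> exists r, relation_of As r.
Proof.
move=> [_ As01 sumAs _].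
have rP (xy : 'I_n.+1 * 'I_n.+1) :
    exists i, forall j, tnth As j xy.1 xy.2 = (i == j)%:R.
  case: xy => x y /=; have := congr1 (fun M : 'M_n.+1 => M x y) sumAs.
  rewrite summxE mxE => sxy.
  have A_ge0 i : 0 <= tnth As i x y by have [_ _ /(_ x y) [] ->] := As01 i.
  have [i /eqP Ai] : exists i, tnth As i x y == 1.
    apply/existsP; apply: contraPT sxy; rewrite negb_exists => /forallP An.
    rewrite big1 => [/eqP|i _]; first by rewrite eq_sym oner_eq0.
    by have [_ _ /(_ x y) [//|/eqP]] := As01 i; rewrite (negPf (An i)).
  exists i => j; have [<-//|ij] := eqVneq i j.
  move: sxy; rewrite (bigD1 i) //= Ai -[RHS]addr0 => /addrI /psumr_eq0P.
  by apply=> //; rewrite eq_sym.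
have [r rE] := fin_all_exists rP.
have {}rE i x y : tnth As i x y = (r (x, y) == i)%:R by rewrite -(rE (x, y)).
exists (fun x y => r (x, y)); split=> // i; have [An0 _ _] := As01 i.
have [[x y] /eqP rxy] : exists xy, r xy == i; last by exists (x, y).
apply/existsP; apply: contra_notT An0; rewrite negb_exists => /forallP rn.
by apply/matrixP => x y; rewrite mxE rE (negPf (rn (x, y))).
Qed.

Lemma scheme_mulE As lam r i j x y : sym_scheme As lam -> relation_of As r ->
  (tnth As i * tnth As j) x y = (lam i j (r x y))%:R.
Proof.
move=> [_ _ _ AsM] [rE _]; rewrite AsM summxE (bigD1 (r x y)) //=.
rewrite big1 => [|l lr]; first by rewrite mxE rE eqxx mulr1 addr0.
by rewrite mxE rE eq_sym (negPf lr) mulr0.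
Qed.

Lemma scheme_table e As lam : relational_qpg e As lam ->
  [/\ sym_table lam, generates lam (idx1 d)
    & forall i x, \sum_y tnth As i x y = (lam i i ord0)%:R].
Proof.
move=> [_ sAs A1 AsU]; have [r rAs] := scheme_relation sAs; have [rE rs] := rAs.
have [As0 As01 _ AsM] := sAs.
have rC x y : r x y = r y x.
  have [_ /matrixP/(_ x y)] := As01 (r x y); rewrite mxE !rE eqxx => + _.
  by case: eqP => // _ /eqP; rewrite eq_sym oner_eq0.
have r0 x : r x x = ord0.
  have := rE ord0 x x; rewrite As0 mxE eqxx.
  by case: eqP => // _ /eqP; rewrite oner_eq0.
have lamE i j x y := scheme_mulE i j x y sAs rAs.
(* The valency is a diagonal entry of the square of [A_i], as [A_i] is a symmetric 0-1 matrix. *)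
have rowE i x : \sum_y tnth As i x y = (lam i i ord0)%:R.
  rewrite -(r0 x) -lamE mxE; apply: eq_bigr => y _.
  by rewrite !rE [r y x]rC -natrM mulnb andbb.
have fAs : free As.
  apply: free_tnth => c cA i; have [[x y] /= <-] := rs i.
  have /matrixP/(_ x y) := cA; rewrite summxE [RHS]mxE (bigD1 (r x y)) //= big1.
    by rewrite mxE rE eqxx mulr1 addr0.
  by move=> l lr; rewrite mxE rE eq_sym (negPf lr) mulr0.
have Al : has_table As lam by move=> i j; apply: AsM.
have tl : sym_table lam.
  split.
  - move=> j l; have [[x y] /= <-] := rs l; apply: (@natr_inj rat).
    by rewrite -lamE As0 mul1r rE eq_sym.
  - move=> i j l; have [[x y] /= <-] := rs l; apply: (@natr_inj rat).
    rewrite -lamE rC -lamE -[tnth As i * _]trmxK -[_ * _]/(_ *m _) trmx_mul.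
    by have [[_ -> _] [_ -> _]] := (As01 i, As01 j); rewrite mxE.
  - by move=> i j m l; apply: has_table_assoc fAs Al.
  - move=> i j ij; apply: (@natr_inj rat); rewrite -(r0 ord0) -lamE mxE big1 // => z _.
    rewrite !rE [r z _]rC; have [->|_] := eqVneq (r ord0 z) i.
      by rewrite (negPf ij) mulr0.
    by rewrite mul0r.
  - move=> i; have [[x y] /= rxy] := rs i; rewrite -(ltr0n rat) -(rowE i x).
    rewrite (bigD1 y) //= rE rxy eqxx ltr_wpDr ?sumr_ge0 // => z _.
    by rewrite rE ler0n.
  move=> i j; apply: (@natr_inj rat); rewrite natrM natr_sum.
  (* Both sides count the walks from a point that make an [A_i] step and then an [A_j] step. *)
  transitivity (\sum_y (tnth As i * tnth As j) ord0 y).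
    rewrite AsM (eq_bigr (fun y => \sum_l (lam i j l)%:R * tnth As l ord0 y)).
      rewrite exchange_big; apply: eq_bigr => l _ /=.
      by rewrite -mulr_sumr rowE natrM.
    by move=> y _; rewrite summxE; apply: eq_bigr => l _; rewrite mxE.
  under eq_bigr do rewrite mxE.
  rewrite exchange_big /= -(rowE i ord0) mulr_suml; apply: eq_bigr => z _.
  by rewrite -mulr_sumr rowE.
split=> //; apply: generates_of_horner As0 fAs Al tl _ => i.
have : tnth As i \in <<1; adj_mx e>>%VS by rewrite -AsU memv_span ?mem_tnth.
by rewrite A1 => /adjoin1P [p ->]; exists p; rewrite map_poly_ratr.
Qed.

(* The matrices of both schemes are the 0-1 indicators of a partition of the
   pairs of points, and span the same space, so the partitions agree. *)
Lemma scheme_unique e As lam As' lam' :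
  relational_qpg e As lam -> relational_qpg e As' lam' ->
  table_iso lam (idx1 d) lam' (idx1 d).
Proof.
move=> [_ sAs A1 AsU] [_ sAs' A1' AsU'].
have [r rAs] := scheme_relation sAs; have [r' rAs'] := scheme_relation sAs'.
have [[rE rs] [rE' rs']] := (rAs, rAs').
(* A matrix of [Cs] is a combination of those of [Bs], hence constant on the classes of [p]. *)
have fine (Bs Cs : d.+1.-tuple 'M[rat]_n.+1) (p q : 'I_n.+1 -> 'I_n.+1 -> 'I_d.+1) :
    (forall i x y, tnth Bs i x y = (p x y == i)%:R) ->
    (forall i x y, tnth Cs i x y = (q x y == i)%:R) ->
    <<Bs>>%VS = <<Cs>>%VS ->
    forall x y u v, p x y = p u v -> q x y = q u v.
  move=> pE qE BC x y u v puv.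
  have : tnth Cs (q x y) \in <<Bs>>%VS by rewrite BC memv_span ?mem_tnth.
  move/coord_span => Cq; have := qE (q x y) u v.
  have := qE (q x y) x y; rewrite Cq !summxE eqxx => e1.
  rewrite (eq_bigr (fun i => (coord Bs i (tnth Cs (q x y)) *: Bs`_i) x y)).
    by rewrite e1; case: eqP => // _ /eqP; rewrite oner_eq0.
  by move=> i _; rewrite !mxE -tnth_nth !pE puv.
have AA : <<As>>%VS = <<As'>>%VS by rewrite AsU AsU'.
have r'r := fine As' As r' r rE' rE (esym AA).
have rr' := fine As As' r r' rE rE' AA.
(* [pt] picks a pair of points in each class of [r]; its class under [r'] defines the matching of
   labels. *)
have [pt ptE] := fin_all_exists rs.
pose s0 i := r' (pt i).1 (pt i).2.
have s0_inj : injective s0 by move=> i j /r'r; rewrite !ptE.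
pose s := perm s0_inj.
have sE x y : s (r x y) = r' x y by rewrite permE; apply: rr'; rewrite ptE.
have sA i : tnth As' (s i) = tnth As i.
  by apply/matrixP => x y; rewrite rE' rE -sE (inj_eq perm_inj).
have A'_inj i j : tnth As' i = tnth As' j -> i = j.
  move=> Aij; have [[x y] /= rxy] := rs' i; have := rE' j x y.
  by rewrite -Aij rE' rxy eqxx; case: eqP => // _ /eqP; rewrite oner_eq0.
have [[As0 _ _ _] [As'0 _ _ _]] := (sAs, sAs').
apply: table_iso_sym; exists s; split.
- by apply: A'_inj; rewrite sA As0 As'0.
- by apply: A'_inj; rewrite sA A1 A1'.
apply: functional_extensionality => i; apply: functional_extensionality => j.
apply: functional_extensionality => l; apply/eqP; rewrite -(eqr_nat rat).
have [[x y] /= <-] := rs l; rewrite /perm_table sE.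
by rewrite -(scheme_mulE i j x y sAs rAs) -(scheme_mulE _ _ x y sAs' rAs') !sA.
Qed.

End Scheme.

(** An array of the graph may come from another scheme generated by it; [scheme_unique] makes the
    table of that scheme isomorphic to [lam], so all such arrays that are valid lie in one class. *)
Lemma qpg_array_class n d k1 (e : rel 'I_n.+1) (As : d.+1.-tuple 'M[rat]_n.+1)
    (lam : 'I_d.+1 -> 'I_d.+1 -> 'I_d.+1 -> nat) : (0 < d)%N ->
    relational_qpg e As lam -> (forall x, #|[pred y | e x y]| = k1) ->
  exists! C : qpg_array d -> Prop,
    array_classes d k1 C /\ exists2 a, C a & array_of_graph e a.
Proof.
move=> d_gt0 eAs ek; have [tl gl rowE] := scheme_table eAs.
have lk : lam (idx1 d) (idx1 d) ord0 = k1.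
  apply/eqP; rewrite -(eqr_nat rat) -(rowE _ ord0) -(ek ord0).
  have [_ _ -> _] := eAs; rewrite -sum1_card natr_sum [X in _ == X]big_mkcond /=.
  by apply/eqP; apply: eq_bigr => y _; rewrite mxE inE; case: (e ord0 y).
have [va al] := array_of_tableP d_gt0 tl gl lk.
exists (array_class k1 (array_of_table lam)); split.
  split; first by exists (array_of_table lam).
  exists (array_of_table lam); first by split=> //; apply: array_equiv_refl va.
  by exists As, lam; split=> // j l jl; rewrite /= jl.
move=> _ [[b vb ->] [a [va' ba] [As' [lam' [eAs' ka la]]]]].
have [tl' gl' rowE'] := scheme_table eAs'.
have al' : array_table a lam'.
  split=> // [i|j l jl]; last by rewrite la.
  by apply/eqP; rewrite -(eqr_nat rat) -(ka i ord0) rowE'.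
rewrite (array_class_eq d_gt0 vb va' ba); apply: array_class_eq => //.
by apply/(array_equivE d_gt0 al al'); apply: scheme_unique eAs eAs'.
Qed.

Theorem theorem2p2 (F : numFieldType) (d k1 : nat) (d_gt0 : (0 < d)%N) :
  (exists Phi : (qpg_array d -> Prop) -> (sita F d * 'I_d.+1 -> Prop),
     bijection_on (array_classes d k1) (gen_sita_classes F d k1) Phi /\
     (forall (a : qpg_array d) (S : sita F d * 'I_d.+1),
        valid_array k1 a -> gen_sita k1 S ->
        (Phi (array_class k1 a) = gen_sita_class k1 S <-> array_of_sita S a)))
  /\
  (forall (n : nat) (e : rel 'I_n.+1) (As : d.+1.-tuple 'M[rat]_n.+1)
          (lam : 'I_d.+1 -> 'I_d.+1 -> 'I_d.+1 -> nat),
     relational_qpg e As lam ->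
     (forall x, #|[pred y | e x y]| = k1) ->
     exists! C : qpg_array d -> Prop,
       array_classes d k1 C /\ exists2 a, C a & array_of_graph e a).
Proof.
split; last by move=> n e As lam; apply: qpg_array_class.
exists (@sitas_of_arrays F d k1); split; first exact: sitas_of_arrays_bij.
move=> a S va gS; split; first exact: array_of_sita_equiv.
exact: sitas_of_array_class.
Qed.
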